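(* Let $d,r\ge1$, let $M_\ell$, $0\le\ell\le r$, be $d\times d$ invertible integer matrices, and let $a_\ell:\mathbb{Z}^d\to\mathbb{R}$, $\ell=1,\dots,r$, be finitely supported masks. Let $\phi$ be a nontrivial (not a.e. zero) compactly supported function in $L^2(\mathbb{R}^d)$. Define $\psi^1,\dots,\psi^r$ by $\widehat{\psi^\ell}(M_\ell^T\xi):=\widehat{a_\ell}(\xi)\hat\phi(\xi)$, that is, $$\psi^\ell:=|\det M_\ell|\sum_{k\in\mathbb{Z}^d}a_\ell(k)\,\phi(M_\ell\cdot-k).$$ Then the following conditions are equivalent. (i) For all $v\in l(\mathbb{Z}^d)$, $$\sum_{\ell=1}^r \mathrm{S}_{a_\ell,M_\ell}\,\mathrm{T}_{a_\ell,M_\ell}\,v=v .$$ (ii) For all $f,g\in L^2(\mathbb{R}^d)$, $$\sum_{k\in\mathbb{Z}^d}\langle f,\phi_{M_0;k}\rangle\langle\phi_{M_0;k},g\rangle=\sum_{\ell=1}^r\sum_{k\in\mathbb{Z}^d}\langle f,\psi^\ell_{M_\ell^{-1}M_0;k}\rangle\langle\psi^\ell_{M_\ell^{-1}M_0;k},g\rangle .$$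
   Context: $l(\mathbb{Z}^d)$ is the space of all complex-valued sequences on $\mathbb{Z}^d$. For an invertible integer $d\times d$ matrix $M$ and a finitely supported sequence (mask) $a:\mathbb{Z}^d\to\mathbb{R}$, the subdivision operator $\mathrm{S}_{a,M}$ and the transition operator $\mathrm{T}_{a,M}$ on $l(\mathbb{Z}^d)$ are $$[\mathrm{S}_{a,M}v](n)=|\det M|\sum_{k\in\mathbb{Z}^d}v(k)\,a(n-Mk),\qquad [\mathrm{T}_{a,M}v](n)=\sum_{k\in\mathbb{Z}^d}v(k)\,\overline{a(k-Mn)} .$$ For a sequence $a$, $\hat a(\xi)=\sum_{k\in\mathbb{Z}^d}a(k)e^{-ik\cdot\xi}$; for a function $f$, $\hat f$ is its Fourier transform, $\hat f(\xi)=\int_{\mathbb{R}^d}f(x)e^{-ix\cdot\xi}\,dx$ for $f\in L^1\cap L^2$. For a function $f$ on $\mathbb{R}^d$, an invertible real $d\times d$ matrix $U$ and $k\in\mathbb{Z}^d$, $f_{U;k}:=|\det U|^{1/2}f(U\cdot-k)$. $\langle\cdot,\cdot\rangle$ is the inner product of $L^2(\mathbb{R}^d)$. *)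

(* Defs.v *)
From HB Require Import structures.
From mathcomp Require Import all_boot all_order all_algebra.
From mathcomp Require Import complex.
From mathcomp Require Import all_classical all_reals all_analysis.
From mathcomp Require summability.
Set Implicit Arguments.
Unset Strict Implicit.
Unset Printing Implicit Defensive.
Import Order.TTheory GRing.Theory Num.Theory.
Import numFieldNormedType.Exports.

Local Open Scope classical_set_scope.
Local Open Scope ring_scope.
Local Open Scope complex_scope.

(* The product sigma-algebra on matrices; for T the Borel line, this is the
   Borel sigma-algebra of 'M[T]_(m, n). *)

Definition measure_matrix_display : measure_display -> measure_display.
Proof. exact. Qed.

Section measurable_matrix.
Context {d} {T : measurableType d}.
Variables m n : nat.

Definition g_sigma_matrix : set (set 'M[T]_(m, n)) :=
  <<s \bigcup_(ij in [set: 'I_m * 'I_n])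
        preimage_set_system setT (fun A : 'M[T]_(m, n) => A ij.1 ij.2)
          measurable >>.

Let matrix_set0 : g_sigma_matrix set0.
Proof. exact: sigma_algebra0. Qed.

Let matrix_setC A : g_sigma_matrix A -> g_sigma_matrix (~` A).
Proof. exact: sigma_algebraC. Qed.

Let matrix_bigcup (F : (set 'M[T]_(m, n))^nat) :
  (forall i, g_sigma_matrix (F i)) -> g_sigma_matrix (\bigcup_i (F i)).
Proof. exact: sigma_algebra_bigcup. Qed.

HB.instance Definition _ := @isMeasurable.Build (measure_matrix_display d)
  'M[T]_(m, n) g_sigma_matrix matrix_set0 matrix_setC matrix_bigcup.

Lemma measurable_coord (i : 'I_m) (j : 'I_n) :
  measurable_fun [set: 'M[T]_(m, n)] (fun A : 'M[T]_(m, n) => A i j).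
Proof.
move=> _ Y mY; apply: sub_sigma_algebra; exists (i, j) => //.
by exists Y.
Qed.

Lemma measurable_fun_matrix d' (S : measurableType d') (f : S -> 'M[T]_(m, n)) :
  (forall i j, measurable_fun [set: S] (fun s => f s i j)) ->
  measurable_fun [set: S] f.
Proof.
move=> mf; apply: (measurability _ (erefl : measurable = g_sigma_matrix)).
move=> _ [_ [[i j] _ [Y mY <-]] <-].
have := mf i j measurableT Y mY; rewrite !setTI.
by rewrite -comp_preimage.
Qed.

End measurable_matrix.

Section cons_cV.
Context (R : realType) (n : nat).

Definition cons_cV (p : measurableTypeR R * 'cV[R]_n) : 'cV[R]_n.+1 :=
  @col_mx R 1 n 1 p.1%:M p.2.

Definition uncons_cV (x : 'cV[R]_n.+1) : measurableTypeR R * 'cV[R]_n :=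
  (x ord0 ord0, @dsubmx R 1 n 1 x).

Lemma cons_cV0 p (j : 'I_1) : cons_cV p ord0 j = p.1.
Proof.
have -> : ord0 = @lshift 1 n ord0 by apply/val_inj.
by rewrite [LHS](@col_mxEu R 1 n 1) mxE !ord1 eqxx mulr1n.
Qed.

Lemma cons_cVS p (i : 'I_n) j : cons_cV p (@rshift 1 n i) j = p.2 i j.
Proof. exact: (@col_mxEd R 1 n 1). Qed.

Lemma cons_cVK : cancel cons_cV uncons_cV.
Proof.
move=> [a v]; rewrite /uncons_cV cons_cV0; congr pair.
exact: (@col_mxKd R 1 n 1).
Qed.

Lemma measurable_cons_cV : measurable_fun [set: measurableTypeR R * 'cV[R]_n] cons_cV.
Proof.
apply: measurable_fun_matrix => i j.
case: (@split_ordP 1 n i) => k ->.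
  have -> : (fun s => cons_cV s (lshift n k) j) = fst.
    apply/funext => s; rewrite -[RHS](cons_cV0 s j).
    by congr (cons_cV s _ j); apply/val_inj; rewrite /= ord1.
  exact: measurable_fst.
have -> : (fun s => cons_cV s (rshift 1 k) j) =
    (fun v : 'cV[R]_n => v k j) \o snd.
  by apply/funext => s; exact: cons_cVS.
by apply: measurableT_comp => //; exact: measurable_coord.
Qed.

Lemma measurable_uncons_cV : measurable_fun [set: 'cV[R]_n.+1] uncons_cV.
Proof.
apply: measurable_fun_pair; first exact: measurable_coord.
apply: measurable_fun_matrix => i j.
under eq_fun do rewrite mxE.
exact: measurable_coord.
Qed.

Variable mu : {sigma_finite_measure set 'cV[R]_n -> \bar R}.

Definition lebesgue_cons : set 'cV[R]_n.+1 -> \bar R :=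
  pushforward (@lebesgue_measure R \x mu)%E cons_cV.

Let lebesgue_cons0 : lebesgue_cons set0 = 0%E.
Proof. by rewrite /lebesgue_cons /pushforward preimage_set0 measure0. Qed.

Let lebesgue_cons_ge0 A : (0 <= lebesgue_cons A)%E.
Proof. exact: (measure_ge0 (@lebesgue_measure R \x mu)%E). Qed.

Let lebesgue_cons_sigma_additive : semi_sigma_additive lebesgue_cons.
Proof.
have mpre A : measurable A -> measurable (cons_cV @^-1` A).
  by move=> mA; rewrite -[X in measurable X]setTI; exact: measurable_cons_cV.
move=> F mF tF mUF; rewrite /lebesgue_cons /pushforward preimage_bigcup.
apply: measure_semi_sigma_additive.
- by move=> k; exact: mpre.
- apply/trivIsetP => i j _ _ ij; rewrite -preimage_setI.
  by move/trivIsetP : tF => /(_ _ _ _ _ ij) ->//; rewrite preimage_set0.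
- by rewrite -preimage_bigcup; exact: mpre.
Qed.

HB.instance Definition _ := isMeasure.Build _ _ _ lebesgue_cons
  lebesgue_cons0 lebesgue_cons_ge0 lebesgue_cons_sigma_additive.

Let lebesgue_cons_sigma_finite : sigma_finite setT lebesgue_cons.
Proof.
have /sigma_finiteP[F [TF ndF Foo]] := sigma_finiteT (@lebesgue_measure R).
have /sigma_finiteP[G [TG ndG Goo]] := sigma_finiteT mu.
exists (fun k => uncons_cV @^-1` (F k `*` G k)).
  rewrite -preimage_bigcup (_ : \bigcup_i (F i `*` G i) = setT) //.
  rewrite -setXTT TF TG predeqE => -[x y]; split.
    by move=> [k _ []/= ? ?]; split; exists k.
  move=> [/= [k _ Fkx] [l _ Gly]]; exists (maxn k l) => //; split.
  - by move: x Fkx; exact/subsetPset/ndF/leq_maxl.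
  - by move: y Gly; exact/subsetPset/ndG/leq_maxr.
move=> k; have [mF Fk] := Foo k; have [mG Gk] := Goo k; split.
  rewrite -[X in measurable X]setTI; apply: measurable_uncons_cV => //.
  exact: measurableX.
rewrite /lebesgue_cons /pushforward -comp_preimage.
rewrite (_ : _ \o _ = id); last by apply/funext => x; exact: cons_cVK.
by rewrite preimage_id product_measure1E// lte_mul_pinfty// ge0_fin_numE.
Qed.

HB.instance Definition _ := Measure_isSigmaFinite.Build _ _ _ lebesgue_cons
  lebesgue_cons_sigma_finite.

End cons_cV.

(* Lebesgue measure on R^d, as the d-fold product of the Lebesgue measure on
   the line. *)
Fixpoint lebesgue_cV (R : realType) (d : nat) :
    {sigma_finite_measure set 'cV[R]_d -> \bar R} :=
  match d with
  | 0 => [the {sigma_finite_measure set _ -> \bar _} of \d_(0 : 'cV[R]_0)]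
  | d'.+1 => [the {sigma_finite_measure set _ -> \bar _} of
                lebesgue_cons (lebesgue_cV R d')]
  end.

Section L2.
Context (R : realType) (d : nat).
Implicit Types f g : 'cV[R]_d -> R[i].

Definition cintegral f : R[i] :=
  (\int[lebesgue_cV R d]_x complex.Re (f x))%R +i*
  (\int[lebesgue_cV R d]_x complex.Im (f x))%R.

(* Functions rather than classes modulo a.e. equality; everything below is
   invariant under a.e. equality. *)
Definition L2 : set ('cV[R]_d -> R[i]) :=
  [set f : 'cV[R]_d -> R[i] |
    [/\ measurable_fun setT (fun x => complex.Re (f x)),
        measurable_fun setT (fun x => complex.Im (f x)) &
        (\int[lebesgue_cV R d]_x
           ((ComplexField.Normc.normc (f x)) ^+ 2)%:E < +oo)%E]].

Definition inner f g : R[i] := cintegral (fun x => f x * (g x)^*).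

Definition nontrivial f := ~ {ae lebesgue_cV R d, forall x, f x = 0}.

Definition compactly_supported f :=
  exists2 K : set 'cV[R]_d,
    compact K & {ae lebesgue_cV R d, forall x, ~ K x -> f x = 0}.

(* |det U|^(1/2) f(U . - k) *)
Definition dilate_shift (U : 'M[R]_d) (k : 'cV[int]_d) f : 'cV[R]_d -> R[i] :=
  fun x => (Num.sqrt `|\det U|)%:C * f (U *m x - map_mx intr k).

End L2.

Section masks.
Context (R : realType) (d : nat).

Definition finitely_supported (a : 'cV[int]_d -> R) :=
  finite_set [set k | a k != 0].

(* In the sums over Z^d below, all but finitely many terms vanish when a is
   finitely supported and \det M != 0. *)

Definition subdivision (a : 'cV[int]_d -> R) (M : 'M[int]_d)
    (v : 'cV[int]_d -> R[i]) : 'cV[int]_d -> R[i] :=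
  fun n => `|\det M|%:~R *
    \sum_(k \in [set: 'cV[int]_d]) v k * (a (n - M *m k))%:C.

Definition transition (a : 'cV[int]_d -> R) (M : 'M[int]_d)
    (v : 'cV[int]_d -> R[i]) : 'cV[int]_d -> R[i] :=
  fun n => \sum_(k \in [set: 'cV[int]_d]) v k * ((a (k - M *m n))%:C)^*.

(* The function psi with hat psi (M^T xi) = hat a (xi) * hat phi (xi). *)
Definition refine (a : 'cV[int]_d -> R) (M : 'M[int]_d)
    (phi : 'cV[R]_d -> R[i]) : 'cV[R]_d -> R[i] :=
  fun x => `|\det M|%:~R *
    \sum_(k \in [set: 'cV[int]_d])
       (a k)%:C * phi (map_mx intr M *m x - map_mx intr k).

(* Unordered sum over Z^d: the limit of the finite partial sums along the
   directed set of finite subsets of Z^d. *)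
Definition lattice_sum (F : 'cV[int]_d -> R[i]) : R[i] :=
  summability.sum (F : _ -> R[i]^o).

(* \sum_(k in Z^d) <f, h_{U;k}> <h_{U;k}, g> *)
Definition frame_sum (U : 'M[R]_d) (h f g : 'cV[R]_d -> R[i]) : R[i] :=
  lattice_sum (fun k =>
    inner f (dilate_shift U k h) * inner (dilate_shift U k h) g).

End masks.

(* Main.v *)
(* Put e_k = phi_{M0;k} and v_f(k) = <f, e_k>. Unfolding psi^l gives
   <f, psi^l_n> = |det M_l|^(1/2) (T_l v_f)(n), and |det M_l| T_l^* = S_l on l^2,
   so (ii) says that <v_f, P v_g> = 0 for all f and g, where P = sum_l S_l T_l - 1;
   the compact support of phi makes v_f square summable. Hence (i) implies (ii).
   Conversely P is a matrix with finite rows and columns. For g in the span of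
   the e_k, P v_g is finitely supported and sum_k (P v_g)(k) e_k is orthogonal to
   every f, hence 0; as the integer shifts of a nontrivial compactly supported
   function are linearly independent, P v_g = 0. Then (P v_g)(n) = 0 says that g
   is orthogonal to the combination of the e_k with the coefficients of the n-th
   row of P, and taking g to be that combination shows that the row vanishes. *)
Require Import Defs.
From HB Require Import structures.
From mathcomp Require Import all_boot all_order all_algebra.
From mathcomp Require Import finmap complex zify ring lra.
From mathcomp Require Import all_classical all_reals all_analysis.
From mathcomp Require Import measurable_realfun.
From mathcomp Require summability.
Set Implicit Arguments.
Unset Strict Implicit.
Unset Printing Implicit Defensive.
Import Order.TTheory GRing.Theory Num.Theory.
Import numFieldNormedType.Exports.

Local Open Scope classical_set_scope.
Local Open Scope ring_scope.
Local Open Scope complex_scope.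
#[local] Existing Instance summability.totally_filter.

(** * Unordered sums *)

Section unordered_sums.
Context (R : realType).
Implicit Types I J : choiceType.
Local Notation normc := ComplexField.Normc.normc.

(** Condition (i) concerns all sequences, without any growth restriction, whereas (ii) only sees the
    sequences [v_f]. The bridge is that each [(P v)(n)] is one fixed finite combination of values of
    [v]: once its coefficients vanish, the growth of [v] is irrelevant. The converse stays inside
    finite combinations of the [e_k] because this system need not be stable. Its synthesis operator
    is bounded on l^2 but may lack a bounded inverse, so coefficients cannot be recovered by a norm
    estimate, and only algebraic independence is at hand. Compact support enters in three ways: it
    makes the Gram matrix of the [e_k] finite in each row and column, it bounds the number of [e_k]
    that are alive at a given point, which yields the Bessel bound, and it starts the propagation
    argument behind linear independence. *)

Lemma normc_ge0 (z : R[i]) : 0 <= normc z.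
Proof. by rewrite -lecR; exact: (@normr_ge0 _ R[i]). Qed.

(** [lattice_sum] is a limit, with a default value where there is none. Sums are therefore added,
    scaled and reindexed only through this predicate, which carries convergence. *)
Definition has_sum I (F : I -> R[i]) (s : R[i]) :=
  summability.partial_sum (F : I -> R[i]^o) @ summability.totally --> (s : R[i]^o).

Lemma has_sumP I (F : I -> R[i]) s :
  has_sum F s <->
  forall e : R, 0 < e -> exists A : {fset I}, forall B : {fset I},
    (A `<=` B)%fset -> normc (\sum_(k <- B) F k - s) < e.
Proof.
have psE B : summability.partial_sum (F : I -> R[i]^o) B = \sum_(k <- B) F k.
  by rewrite /summability.partial_sum big_seq_fsetE.
split=> [/cvgrPdist_lt Fs e e0|Fs].
  have e0' : 0 < e%:C :> R[i] by rewrite ltcR.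
  have [A _ AB] := Fs _ e0'.
  by exists A => B /AB /=; rewrite psE distrC ltcR.
apply/cvgrPdist_lt => e e0.
(* A positive element of [R[i]] is real, since the order only compares numbers with equal imaginary
   parts. *)
have [e' e'E] : exists e' : R, e = e'%:C.
  by exists (complex.Re e); move: e0; case: e => a b; rewrite ltcE /= => /andP[/eqP -> _].
rewrite e'E ltcR in e0; have [A AB] := Fs _ e0.
exists A => // B /AB /=; rewrite e'E psE.
by rewrite -normrN opprB /= ltcR.
Qed.

Lemma has_sum_lattice d (F : 'cV[int]_d -> R[i]) s :
  has_sum F s -> lattice_sum F = s.
Proof.
move=> Fs; rewrite /lattice_sum /summability.sum.
by apply: (@cvg_lim R[i]^o) => //; exact: (@norm_hausdorff _ R[i]^o).
Qed.

Lemma has_sumD I (F G : I -> R[i]) s t :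
  has_sum F s -> has_sum G t -> has_sum (fun k => F k + G k) (s + t).
Proof.
move=> /has_sumP Fs /has_sumP Gt; apply/has_sumP => e e0.
have e20 : 0 < e / 2 by rewrite divr_gt0.
have [A AF] := Fs _ e20; have [B BG] := Gt _ e20.
exists (A `|` B)%fset => C; rewrite fsubUset => /andP[/AF CF /BG CG].
rewrite big_split /= opprD addrACA (splitr e).
by apply: (le_lt_trans (le_normcD _ _)); rewrite ltrD.
Qed.

Lemma has_sumZ I (F : I -> R[i]) s c :
  has_sum F s -> has_sum (fun k => c * F k) (c * s).
Proof.
move=> /has_sumP Fs; apply/has_sumP => e e0.
have c0 : 0 < normc c + 1 by rewrite ltr_wpDl// normc_ge0.
have [A AF] := Fs (e / (normc c + 1)) (divr_gt0 e0 c0).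
exists A => C /AF; rewrite -mulr_sumr -mulrBr ComplexField.Normc.normcM.
rewrite ltr_pdivlMr// mulrC; apply: le_lt_trans.
by rewrite ler_wpM2r ?lerDl ?normc_ge0.
Qed.

Lemma has_sum0 I : has_sum (fun _ : I => 0) 0.
Proof.
apply/has_sumP => e e0; exists fset0 => B _.
by rewrite big1// subrr ComplexField.Normc.normc0.
Qed.

Lemma has_sum_big I (T : Type) (r : seq T) (F : T -> I -> R[i]) s :
  (forall i, has_sum (F i) (s i)) ->
  has_sum (fun k => \sum_(i <- r) F i k) (\sum_(i <- r) s i).
Proof.
move=> Fs; elim: r => [|i r IH].
  have -> : (fun k => \sum_(i <- [::]) F i k) = fun=> 0.
    by apply/funext => k; rewrite big_nil.
  by rewrite big_nil; exact: has_sum0.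
have -> : (fun k => \sum_(j <- i :: r) F j k) =
    fun k => F i k + \sum_(j <- r) F j k by apply/funext => k; rewrite big_cons.
by rewrite big_cons; exact: (has_sumD (Fs i) IH).
Qed.

Lemma has_sum_fin I (F : I -> R[i]) (r : seq I) :
  uniq r -> (forall k, k \notin r -> F k = 0) -> has_sum F (\sum_(k <- r) F k).
Proof.
move=> ur F0; apply/has_sumP => e e0; exists [fset k in r]%fset => B rB.
rewrite [X in normc X](_ : _ = 0) ?ComplexField.Normc.normc0//.
apply/eqP; rewrite subr_eq0; apply/eqP.
rewrite (bigID (mem r)) /= [X in _ + X]big1 ?addr0; last by move=> i; exact: F0.
rewrite -big_filter; apply: perm_big; apply: uniq_perm => //.
  by rewrite filter_uniq// fset_uniq.
move=> k; rewrite mem_filter; apply/andP/idP => [[]//|kr]; split=> //.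
by apply: (fsubsetP rB); rewrite inE.
Qed.

(** Off the range of [h] the terms vanish, so a finite set containing the image of [A] has the same
    partial sum as its preimage, which contains [A]. *)
Lemma has_sum_reindex I J (h : I -> J) (G : J -> R[i]) s :
  injective h -> (forall k, (forall j, k <> h j) -> G k = 0) ->
  has_sum (G \o h) s -> has_sum G s.
Proof.
move=> hI G0 /has_sumP Gs; apply/has_sumP => e /Gs[A AG].
exists (h @` A)%fset => B AB.
(* The partial inverse [g] of [h] needs a default value, so an empty [I] is treated apart; [G] is
   then identically 0. *)
have [[x0 _]|noI] := pselect (exists x : I, True); last first.
  rewrite (eq_bigr (fun _ => 0)) => [|k _]; last first.
    by apply: G0 => j _; apply: noI; exists j.
  have := AG A (fsubset_refl _); rewrite [X in normc (X - _)]big1//=.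
    by rewrite [X in _ -> normc (X - _) < _]big1.
  by move=> i _; exfalso; apply: noI; exists i.
pose im k := `[< exists j, k = h j >].
pose g k := if pselect (exists j, k = h j) is left P then projT1 (cid P) else x0.
have gK k : im k -> h (g k) = k.
  by rewrite /im /g => /asboolP; case: pselect => // P _; case: cid => /= j ->.
pose C := (g @` [fset k in B | im k])%fset.
have AC : (A `<=` C)%fset.
  apply/fsubsetP => a aA; have ima : im (h a) by apply/asboolP; exists a.
  apply/imfsetP; exists (h a) => /=; last by apply: hI; rewrite gK.
  by rewrite !inE ima andbT; apply: (fsubsetP AB); rewrite in_imfset.
suff <- : \sum_(k <- C) (G \o h) k = \sum_(k <- B) G k by exact: AG.
rewrite /C big_imfset /=; last first.
  move=> x y; rewrite !inE => /andP[_ xi] /andP[_ yi] xy.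
  by rewrite -(gK x xi) -(gK y yi) xy.
rewrite [RHS](bigID im) /= [X in _ + X]big1 ?addr0; last first.
  by move=> k /asboolPn nk; apply: G0 => j kj; apply: nk; exists j.
rewrite -[RHS]big_filter big_seq_cond [RHS]big_seq_cond.
rewrite (eq_bigr G) => [|k]; last by rewrite !inE !andbT => /andP[_ /gK ->].
rewrite -!big_seq_cond; apply: perm_big; apply: uniq_perm.
- exact: fset_uniq.
- by rewrite filter_uniq// fset_uniq.
- by move=> k; rewrite !inE mem_filter andbC.
Qed.

Lemma ge0_bounded_has_sum I (F : I -> R) C :
  (forall k, 0 <= F k) -> (forall A : {fset I}, \sum_(k <- A) F k <= C) ->
  exists s, has_sum (fun k => (F k)%:C) s.
Proof.
move=> F0 FC; pose E := [set \sum_(k <- A) F k | A in [set: {fset I}]].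
have supE : has_sup E.
  by split; [exists (\sum_(k <- fset0) F k), fset0|exists C => _ [A _ <-]].
exists (sup E)%:C; apply/has_sumP => e e0.
have [_ [A _ <-] Ae] := sup_adherent e0 supE.
exists A => B AB.
rewrite -rmorph_sum -rmorphB /= expr0n addr0 sqrtr_sqr.
have BE : \sum_(k <- B) F k <= sup E by apply: ub_le_sup; [exact: supE.2|exists B].
rewrite ler0_norm ?subr_le0// opprB ltrBlDr -ltrBlDl (lt_le_trans Ae)//.
rewrite [leRHS](bigID (mem A)) /= -[leLHS]addr0 lerD ?sumr_ge0//.
rewrite -[leRHS]big_filter le_eqVlt; apply/orP; left; apply/eqP.
apply: perm_big; apply: uniq_perm => //.
  by rewrite filter_uniq.
by move=> k; rewrite mem_filter; apply/idP/andP => [kA|[]//]; split=> //; exact: (fsubsetP AB).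
Qed.

(** Real and imaginary parts are split into positive and negative parts, each dominated by
    [normc (F k)] and hence summable to the supremum of its partial sums. *)
Lemma normc_bounded_has_sum I (F : I -> R[i]) C :
  (forall A : {fset I}, \sum_(k <- A) normc (F k) <= C) -> exists s, has_sum F s.
Proof.
move=> FC.
have real G : (forall k, `|G k| <= normc (F k)) -> exists s, has_sum (fun k => (G k)%:C) s.
  move=> GF.
  have [||s Ps] := @ge0_bounded_has_sum I (fun k => Num.max (G k) 0) C.
  - by move=> k; rewrite le_max lexx orbT.
  - move=> A; apply: le_trans (FC A); apply: ler_sum => k _.
    by rewrite ge_max normc_ge0 andbT (le_trans (ler_norm _)).
  have [||t Pt] := @ge0_bounded_has_sum I (fun k => Num.max (- G k) 0) C.
  - by move=> k; rewrite le_max lexx orbT.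
  - move=> A; apply: le_trans (FC A); apply: ler_sum => k _.
    by rewrite ge_max normc_ge0 andbT (le_trans (ler_norm _))// normrN.
  exists (s + (-1) * t).
  have := has_sumD Ps (has_sumZ (c := -1) Pt); congr has_sum; apply/funext => k.
  rewrite mulN1r -rmorphB; congr (_%:C).
  have [Gk|Gk] := leP 0 (G k).
    by rewrite max_r ?oppr_le0// subr0.
  by rewrite max_l ?oppr_ge0 ?ltW// sub0r opprK.
have [s Ps] : exists s, has_sum (fun k => (complex.Re (F k))%:C) s.
  apply: real => k; case: (F k) => x y /=.
  by rewrite -[leLHS]sqrtr_sqr ler_wsqrtr// lerDl sqr_ge0.
have [t Pt] : exists s, has_sum (fun k => (complex.Im (F k))%:C) s.
  apply: real => k; case: (F k) => x y /=.
  by rewrite -[leLHS]sqrtr_sqr ler_wsqrtr// lerDr sqr_ge0.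
exists (s + 'i * t); have := has_sumD Ps (has_sumZ (c := 'i) Pt); congr has_sum.
by apply/funext => k; rewrite [RHS]complexE.
Qed.

End unordered_sums.

(** * Linear change of variables in R^d *)

Section linear_change_of_variables.
Context (R : realType).
Local Notation mu := (@lebesgue_measure R).

(** Uniqueness of Lebesgue measure: the pushforward along the affine map, rescaled by [|a|], gives
    each half-open interval its length. A negative [a] only exchanges the closed and the open
    end. *)
Lemma lebesgue_measure_affine (a b : R) (A : set (measurableTypeR R)) :
  a != 0 -> measurable A ->
  mu ((fun t => a * t + b) @^-1` A) = (`|a|^-1%:E * mu A)%E.
Proof.
move=> a0 mA.
have mf : measurable_fun [set: measurableTypeR R]
    (fun t : measurableTypeR R => a * t + b : measurableTypeR R).
  by apply: measurable_funD => //; apply: measurable_funM.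
pose f (t : measurableTypeR R) : measurableTypeR R := a * t + b.
have na0 : 0 < `|a| by rewrite normr_gt0.
pose k : {nonneg R} := NngNum (ltW na0).
pose pm : {measure set (measurableTypeR R) -> \bar R} :=
  measure_function_pushforward__canonical__measure_function_Measure mu mf.
suff : mu A = mscale k pm A.
  by move=> ->; rewrite /mscale /= muleA -EFinM mulVf ?gt_eqF// mul1e.
apply: (lebesgue_measure_unique (mu := mscale k pm)) => //= _ [[x y]] _ <-.
change (mu `]x, y] = (`|a|%:E * mu (f @^-1` `]x, y]))%E).
have [an|ap|az] := ltrgtP a 0; last by rewrite az eqxx in a0.
- have -> : f @^-1` `]x, y] = `[(y - b) / a, (x - b) / a[%classic.
    apply/seteqP; split=> t /=;
      by rewrite !in_itv /= ler_ndivrMr// ltr_ndivlMr// lerBrDr ltrBlDr 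
        [t * a]mulrC => /andP[-> ->].
  rewrite !lebesgue_measure_itv /= !lte_fin ltr_ndivrMr// divfK// ltrD2r.
  case: ifPn => xy; last by rewrite mule0.
  rewrite -!EFinD -EFinM; congr EFin; rewrite ltr0_norm//.
  by rewrite -mulrBl mulrC -mulrA mulrN mulVf// mulrN1; ring.
- have -> : f @^-1` `]x, y] = `](x - b) / a, (y - b) / a]%classic.
    apply/seteqP; split=> t /=;
      by rewrite !in_itv /= ler_pdivlMr// ltr_pdivrMr// lerBrDr ltrBlDr 
        [t * a]mulrC => /andP[-> ->].
  rewrite !lebesgue_measure_itv /= !lte_fin ltr_pdivrMr// divfK// ltrD2r.
  case: ifPn => xy; last by rewrite mule0.
  rewrite -!EFinD -EFinM; congr EFin; rewrite gtr0_norm//.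
  by rewrite -mulrBl mulrC divfK//; ring.
Qed.

Lemma ge0_integral_affine (a b : R) (h : measurableTypeR R -> \bar R) :
  a != 0 -> measurable_fun setT h -> (forall t, (0 <= h t)%E) ->
  (\int[mu]_t h (a * t + b)%R = `|a|^-1%:E * \int[mu]_t h t)%E.
Proof.
move=> a0 mh h0.
have mf : measurable_fun [set: measurableTypeR R]
    (fun t : measurableTypeR R => a * t + b : measurableTypeR R).
  by apply: measurable_funD => //; apply: measurable_funM.
pose k : {nonneg R} := NngNum (eqbRL (invr_ge0 `|a|) (normr_ge0 a)).
rewrite -(@ge0_integral_mscale _ _ _ mu setT measurableT k)//.
have := @ge0_integral_pushforward _ _ _ _ R _ mf mu setT h measurableT mh (fun y _ => h0 y).
rewrite preimage_setT => <-.
apply: eq_measure_integral => A mA _.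
exact: lebesgue_measure_affine.
Qed.

Lemma ge0_integral_lebesgue_cons d (h : 'cV[R]_d.+1 -> \bar R) :
  measurable_fun setT h -> (forall x, 0 <= h x)%E ->
  (\int[lebesgue_cV R d.+1]_x h x =
   \int[(mu \x lebesgue_cV R d)%E]_p h (cons_cV p))%E.
Proof.
move=> mh h0.
have := @ge0_integral_pushforward _ _ _ _ R _ (@measurable_cons_cV R d)
  (mu \x lebesgue_cV R d)%E setT h measurableT mh (fun y _ => h0 y).
by rewrite preimage_setT => <-.
Qed.

Lemma measurable_affine_cV d d' (A : 'M[R]_(d', d)) (b : 'cV[R]_d') :
  measurable_fun [set: 'cV[R]_d] (fun x : 'cV[R]_d => A *m x + b).
Proof.
apply: measurable_fun_matrix => i j.
rewrite (_ : (fun s : 'cV[R]_d => _) = fun s : 'cV[R]_d => \sum_k A i k * s k j + b i j).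
  apply: measurable_funD => //; apply: measurable_sum => k.
  by apply: measurable_funM => //; exact: measurable_coord.
by apply/funext => s; rewrite !mxE.
Qed.

Definition change_of_variables d (f : 'cV[R]_d -> 'cV[R]_d) (c : R) :=
  forall h : 'cV[R]_d -> \bar R, measurable_fun setT h -> (forall x, 0 <= h x)%E ->
    (\int[lebesgue_cV R d]_x h (f x) = c%:E * \int[lebesgue_cV R d]_x h x)%E.

Lemma cons_cVE d (t : R) (v : 'cV[R]_d) : cons_cV (t, v) = @col_mx R 1 d 1 t%:M v.
Proof. by []. Qed.

Lemma block_mx_cons_cV d (al b0 : R) (u : 'rV[R]_d) (l b1 : 'cV[R]_d) (D : 'M[R]_d)
    (t : R) (v : 'cV[R]_d) :
  @block_mx R 1 d 1 d al%:M u l D *m cons_cV (t, v) + cons_cV (b0, b1) =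
  cons_cV (al * t + ((u *m v) 0 0 + b0), t *: l + D *m v + b1).
Proof.
rewrite !cons_cVE [LHS](_ : _ =
  @col_mx R 1 d 1 (al *: t%:M + u *m v + b0%:M) (l *m t%:M + D *m v + b1)).
  congr (@col_mx R 1 d 1 _ _); last by rewrite mul_mx_scalar.
  by apply/matrixP => i j; rewrite !ord1 !mxE /= !mulr1n addrA.
by rewrite mul_block_col [LHS](@add_col_mx R 1 d 1) mul_scalar_mx.
Qed.

(* (t, v) |-> (al t + u v + b0, v), integrated in t first, followed by
   (t', v) |-> (t', S v + t' l / al + const), integrated in v first, where
   S = D - l u / al is the Schur complement. *)
Lemma block_change_of_variables d (al b0 : R) (u : 'rV[R]_d) (l b1 : 'cV[R]_d)
    (D : 'M[R]_d) (c : R) :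
  al != 0 -> 0 <= c ->
  (forall b, change_of_variables (fun x => (D - al^-1 *: (l *m u)) *m x + b) c) ->
  change_of_variables
    (fun x => @block_mx R 1 d 1 d al%:M u l D *m x + cons_cV (b0, b1)) (`|al|^-1 * c).
Proof.
move=> al0 c0 covS h mh h0.
pose S := D - al^-1 *: (l *m u).
pose w (s : R) := s *: (al^-1 *: l) + (b1 - b0 *: (al^-1 *: l)).
pose G (p : measurableTypeR R * 'cV[R]_d) := h (cons_cV (p.1, S *m p.2 + w p.1)).
have mG : measurable_fun setT G.
  apply: measurableT_comp => //; apply: measurableT_comp; first exact: measurable_cons_cV.
  apply: measurable_fun_pair => //=.
  apply: measurable_fun_matrix => i j.
  rewrite (_ : (fun s => _) = fun s : measurableTypeR R * 'cV[R]_d =>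
     \sum_k S i k * s.2 k j +
     (s.1 * (al^-1 *: l) i j + (b1 - b0 *: (al^-1 *: l)) i j)); last first.
    by apply/funext => s; rewrite [LHS]mxE; congr (_ + _); [rewrite mxE|rewrite /w !mxE].
  apply: measurable_funD => //; [apply: measurable_sum => k|].
    apply: measurable_funM => //.
    exact: (measurableT_comp (measurable_coord k j) measurable_snd).
  by apply: measurable_funD => //; apply: measurable_funM.
have G0 p : (0 <= G p)%E by exact: h0.
have hG t v : h (@block_mx R 1 d 1 d al%:M u l D *m cons_cV (t, v) + cons_cV (b0, b1)) =
    G (al * t + ((u *m v) 0 0 + b0), v).
  rewrite block_mx_cons_cV /G /=; congr (h (cons_cV (_, _))).
  rewrite /S /w mulmxBl -scalemxAl -mulmxA.
  have -> : l *m (u *m v) = (u *m v) 0 0 *: l.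
    by rewrite {1}[u *m v]mx11_scalar mul_mx_scalar.
  move: ((u *m v) 0 0) => z; apply/matrixP => i j; rewrite !mxE.
  by field.
pose B := @block_mx R 1 d 1 d al%:M u l D.
have mhB : measurable_fun [set: 'cV[R]_d.+1] (fun x => h (B *m x + cons_cV (b0, b1))).
  exact: (measurableT_comp mh (measurable_affine_cV _ _)).
rewrite ge0_integral_lebesgue_cons//.
rewrite (fubini_tonelli2 (fun p => h (B *m cons_cV p + cons_cV (b0, b1))))//=; last first.
  exact: (measurableT_comp mhB (@measurable_cons_cV R d)).
transitivity (\int[lebesgue_cV R d]_v (`|al|^-1%:E * \int[mu]_t G (t, v)))%E.
  apply: eq_integral => v _; rewrite /fubini_G.
  rewrite -(ge0_integral_affine ((u *m v) 0 0 + b0) al0) => [||t//].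
    by apply: eq_integral => t _; exact: hG.
  exact: (measurableT_comp mG (pair2_measurable v)).
rewrite ge0_integralZl//; last 2 first.
- exact: (measurable_fun_fubini_tonelli_G (m1 := mu) G mG G0).
- by move=> v _; apply: integral_ge0 => t _; exact: G0.
rewrite -(fubini_tonelli G)// EFinM -muleA; congr (_ * _)%E.
transitivity (\int[mu]_t (c%:E * \int[lebesgue_cV R d]_v h (cons_cV (t, v))))%E.
  apply: eq_integral => t _; rewrite /G /=.
  apply: covS => //.
  exact: (measurableT_comp mh
    (measurableT_comp (@measurable_cons_cV R d) (pair1_measurable t))).
rewrite ge0_integralZl//; last 2 first.
- apply: (measurable_fun_fubini_tonelli_F (fun p => h (cons_cV p))) => //.
  exact: (measurableT_comp mh (@measurable_cons_cV R d)).
- by move=> t _; apply: integral_ge0.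
congr (_ * _)%E; rewrite ge0_integral_lebesgue_cons//.
rewrite (fubini_tonelli1 (fun p => h (cons_cV p)))//.
exact: (measurableT_comp mh (@measurable_cons_cV R d)).
Qed.

(** Block LU factorization: clearing the column below the pivot leaves a block triangular matrix
    whose diagonal blocks are [al] and the Schur complement. *)
Lemma unitmx_schur d (al : R) (u : 'rV[R]_d) (l : 'cV[R]_d) (D : 'M[R]_d) :
  al != 0 -> @block_mx R 1 d 1 d al%:M u l D \in unitmx ->
  D - al^-1 *: (l *m u) \in unitmx.
Proof.
move=> al0.
have -> : @block_mx R 1 d 1 d al%:M u l D =
    @block_mx R 1 d 1 d 1%:M 0 (al^-1 *: l) 1%:M *m
    @block_mx R 1 d 1 d al%:M u 0 (D - al^-1 *: (l *m u)).
  rewrite (@mulmx_block R 1 d 1 d 1 d) !mul1mx !mul0mx !addr0.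
  by rewrite mul_mx_scalar scalerA mulfV// scale1r -scalemxAl addrC subrK.
rewrite unitmx_mul => /andP[_]; rewrite !unitmxE (@det_ublock R 1 d) det_scalar1 unitrM.
by case/andP.
Qed.

(** Induction on the dimension through the Schur complement of a nonzero corner entry, which a shear
    produces if necessary. The factor is kept abstract; what matters later is that one [c] serves
    all translations [b]. *)
Lemma affine_change_of_variables d (A : 'M[R]_d) :
  A \in unitmx ->
  exists2 c, 0 < c & forall b, change_of_variables (fun x => A *m x + b) c.
Proof.
elim: d A => [|d IH] A Au.
  exists 1 => // b h mh h0; rewrite mul1e; apply: eq_integral => x _.
  by congr h; apply/matrixP => -[].
have pivot (B : 'M[R]_d.+1) : B \in unitmx -> B ord0 ord0 != 0 ->
    exists2 c, 0 < c & forall b, change_of_variables (fun x => B *m x + b) c.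
  move=> Bu al0; set al := B _ _ in al0.
  pose u : 'rV_d := @ursubmx R 1 d 1 d B; pose l : 'cV_d := @dlsubmx R 1 d 1 d B.
  pose D : 'M[R]_d := @drsubmx R 1 d 1 d B.
  have BE : B = @block_mx R 1 d 1 d al%:M u l D.
    rewrite -[LHS](@submxK R 1 d 1 d); congr (@block_mx R 1 d 1 d _ _ _ _).
    rewrite [LHS]mx11_scalar; congr (_%:M); rewrite !mxE /al.
    by congr (B _ _); apply/val_inj.
  rewrite BE in Bu *.
  have [c c0 cS] := IH _ (unitmx_schur al0 Bu).
  exists (`|al|^-1 * c); first by rewrite mulr_gt0// invr_gt0 normr_gt0.
  move=> b; have -> : b = cons_cV (b ord0 ord0, @dsubmx R 1 d 1 b).
    rewrite -[LHS](@vsubmxK R 1 d 1); congr (@col_mx R 1 d 1 _ _).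
    rewrite [LHS]mx11_scalar; congr (_%:M); rewrite !mxE /=.
    by congr (b _ _); apply/val_inj.
  by apply: block_change_of_variables => //; exact: ltW.
have [A0|A0] := eqVneq (A ord0 ord0) 0; last exact: pivot.
have [i Ai0] : exists i, A i ord0 != 0.
  apply/existsP; apply: contraTT Au => /existsPn nA.
  rewrite unitmxE unitfE negbK; apply/eqP.
  rewrite (expand_det_col _ ord0) big1// => i _.
  by move: (nA i); rewrite negbK => /eqP ->; rewrite mul0r.
have i0 : i != ord0 by apply: contraNneq Ai0 => ->; rewrite A0.
(* Adding row i to row 0 makes the corner entry nonzero. *)
pose E c : 'M[R]_d.+1 := 1%:M + c *: delta_mx ord0 i.
have EE c e : E c *m E e = E (c + e).
  rewrite /E mulmxDl !mulmxDr !mul1mx mulmx1 -scalemxAl -scalemxAr.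
  by rewrite mul_delta_mx_cond (negbTE i0) mulr0n !scaler0 addr0 scalerDl addrAC addrA.
have E0 : E 0 = 1%:M by rewrite /E scale0r addr0.
have Eu c : E c \in unitmx.
  have : E c *m E (- c) = 1%:M by rewrite EE subrr.
  by move=> /mulmx1_unit[].
have [||c c0 cA] := pivot (E 1 *m A).
- by rewrite unitmx_mul Eu.
- rewrite /E mulmxDl mul1mx mxE A0 add0r -scalemxAl mxE mul1r.
  rewrite mxE (bigD1 i)//= big1 => [|j ji]; last by rewrite mxE (negbTE ji) andbF mul0r.
  by rewrite mxE !eqxx mul1r addr0.
have [||e e0 Ee] := pivot (E (-1)); first exact: Eu.
  by rewrite /E !mxE eqxx [ord0 == i]eq_sym (negbTE i0) mulr0 addr0 oner_neq0.
exists (c * e) => [|b h mh h0]; first exact: mulr_gt0.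
(* [A *m x + b] is [E (-1)] applied to [E 1 *m A *m x + E 1 *m b]. Both linear parts have a nonzero
   corner entry, and the two factors multiply. *)
pose g x := h (E (-1) *m x + 0).
have mg : measurable_fun setT g.
  exact: (measurableT_comp mh (measurable_affine_cV _ _)).
have := cA (E 1 *m b) g mg (fun x => h0 _).
rewrite /g Ee// muleA -EFinM => <-; apply: eq_integral => x _.
by rewrite addr0 -mulmxA -mulmxDr mulmxA EE addNr E0 mul1mx.
Qed.

End linear_change_of_variables.

(** * Linear independence of integer shifts *)

Section shifts.
Context (R : realType) (d : nat).
Local Notation mu := (lebesgue_cV R d).

(** The change of variables, applied to the indicator of a null set, shows that its preimage is
    null. *)
Lemma ae_affine (A : 'M[R]_d) b (P : 'cV[R]_d -> Prop) :
  A \in unitmx -> {ae mu, forall x, P x} -> {ae mu, forall x, P (A *m x + b)}.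
Proof.
move=> Au [N [mN N0 PN]]; have [c c0 cov] := affine_change_of_variables Au.
have mA : measurable_fun [set: 'cV[R]_d] (fun x : 'cV[R]_d => A *m x + b).
  exact: measurable_affine_cV.
have mN' : measurable ((fun x => A *m x + b) @^-1` N).
  by rewrite -[X in measurable X]setTI; exact: mA.
exists ((fun x => A *m x + b) @^-1` N); split=> //; last by move=> x Px; exact: PN.
pose h x : \bar R := (\1_N x)%:E.
have mh : measurable_fun setT h by exact/measurable_EFinP/measurable_indic.
have := cov b h mh (fun x => ler0n _ _).
rewrite /h [in RHS]integral_indic//.
rewrite setIT [X in (_ * X)%E](N0 : _ = 0%E) mule0 => <-.
by rewrite -[in LHS](setIT (_ @^-1` _)) -integral_indic.
Qed.

Lemma ae_shift b (P : 'cV[R]_d -> Prop) :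
  {ae mu, forall x, P x} -> {ae mu, forall x, P (x + b)}.
Proof.
move=> /(ae_affine b (unitmx1 R d)); apply: filterS => x /=.
by rewrite mul1mx.
Qed.

Lemma ae_forall_countable (T : countType) (P : T -> 'cV[R]_d -> Prop) :
  (forall k, {ae mu, forall x, P k x}) -> {ae mu, forall x, forall k, P k x}.
Proof.
move=> aeP.
have : {ae mu, forall x, forall n,
    if (choice.unpickle n : option T) is Some k then P k x else True}.
  apply: ae_foralln => n; case: choice.unpickle => [k|]; first exact: aeP.
  exact: aeW.
apply: filterS => x Px k; have := Px (choice.pickle k); by rewrite choice.pickleK.
Qed.

(* Evaluate at l = (1, t, t^2, ...): each nonzero k is a nonzero polynomial in t,
   and some integer t avoids the finitely many roots. *)
Lemma separating_functional (r : seq 'cV[int]_d) :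
  exists l : 'rV[int]_d, forall k, k \in r -> k != 0 -> (l *m k) 0 0 != 0.
Proof.
pose p (k : 'cV[int]_d) : {poly int} := rVpoly k^T.
pose P := \prod_(k <- r | k != 0) p k.
have P0 : P != 0.
  rewrite prodf_seq_neq0; apply/allP => k _; apply/implyP => k0.
  apply: contra k0 => /eqP pk.
  by rewrite -(trmxK k) -[k^T]rVpolyK -/(p k) pk linear0 trmx0.
have [t tP] : exists t : int, ~~ root P t.
  pose s := map Posz (iota 0 (size P)).
  have us : uniq s by rewrite map_inj_uniq ?iota_uniq// => m n [].
  have [/(max_poly_roots P0)/(_ us)|/allPn[t _ tP]] := boolP (all (root P) s).
    by rewrite size_map size_iota ltnn.
  by exists t.
exists (\row_i t ^+ i) => k kr k0; apply: contra tP => /eqP kt.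
rewrite /P (big_rem k)//= k0 rootM; apply/orP; left.
apply/rootP; rewrite -[RHS]kt /p /rVpoly horner_poly mxE; apply: eq_bigr => i _.
by rewrite valK !mxE mulrC.
Qed.

Lemma compactly_supported_bounded (phi : 'cV[R]_d -> R[i]) :
  compactly_supported phi -> exists L : R,
    {ae mu, forall x, phi x != 0 -> forall i, `|x i 0| <= L}.
Proof.
case=> K /compact_bounded/pinfty_ex_gt0[L L0 KL] Kphi; exists L.
apply: filterS Kphi => x Kx phi0 i.
have xK : K x by apply: contrapT => /Kx phx; rewrite phx eqxx in phi0.
apply: le_trans (KL _ xK).
rewrite [leRHS]mx_normrE.
exact: (le_bigmax _ (fun ij : 'I_d * 'I_1 => `|x ij.1 ij.2|) (i, 0)).
Qed.

(* Let km be the index of a nonzero coefficient on which lam is largest. The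
   relation expresses phi(x) through values phi(y) with lam y >= lam x + 1, so
   the vanishing of phi where lam is large propagates to all of R^d. *)
Lemma shifts_linearly_independent (phi : 'cV[R]_d -> R[i]) (L : R)
    (F : seq 'cV[int]_d) (c : 'cV[int]_d -> R[i]) :
  nontrivial phi ->
  {ae mu, forall x, phi x != 0 -> forall i, `|x i 0| <= L} ->
  uniq F ->
  {ae mu, forall x, \sum_(k <- F) c k * phi (x - map_mx intr k) = 0} ->
  forall k, k \in F -> c k = 0.
Proof.
move=> ntphi Lphi uF cphi k0 k0F; apply/eqP; apply: contrapT => /negP ck0.
(* Taken on differences, [l] separates the points of [F]: the maximum of [lam] is attained once,
   and, values being integers, by a margin of at least 1. *)
have [l lP] := separating_functional [seq k - k' | k <- F, k' <- F].
pose lam (k : 'cV[int]_d) : int := (l *m k) 0 0.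
have lamB k k' : lam (k - k') = lam k - lam k' by rewrite /lam mulmxBr !mxE.
pose F' := [seq k <- F | c k != 0].
have [km kmF kmax] : exists2 km, km \in F' & forall k, k \in F' -> lam k <= lam km.
  have k0F' : k0 \in F' by rewrite mem_filter ck0.
  have i0P : (index k0 F' < size F')%N by rewrite index_mem.
  have [|i _ imax] := @arg_maxP _ _ _ (Ordinal i0P) xpredT
    (fun i : 'I_(size F') => lam (nth 0 F' i)); first by [].
  exists (nth 0 F' i); first exact: mem_nth.
  move=> k kF; have iP : (index k F' < size F')%N by rewrite index_mem.
  by have /= := imax (Ordinal iP) isT; rewrite nth_index.
have [ckm kmF0] : c km != 0 /\ km \in F by move: kmF; rewrite mem_filter => /andP.
pose lamR (x : 'cV[R]_d) : R := (map_mx intr l *m x) 0 0.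
have lamRD x y : lamR (x + y) = lamR x + lamR y by rewrite /lamR mulmxDr mxE.
have lamRi k : lamR (map_mx intr k) = (lam k)%:~R by rewrite /lamR -map_mxM mxE.
(* [B] bounds [lamR] on the box outside which [phi] vanishes. The induction starts there and lowers
   the threshold by 1 at each round. *)
pose B := \sum_i `|(l 0 i)%:~R| * L : R.
have claim n : {ae mu, forall x, B - n%:R < lamR x -> phi x = 0}.
  elim: n => [|n IH].
    apply: filterS Lphi => x phiL; rewrite subr0 => Bx.
    apply/eqP; apply: contraLR Bx => /phiL xL; rewrite -leNgt.
    rewrite /lamR mxE; apply: ler_sum => i _; rewrite mxE.
    by rewrite (le_trans (ler_norm _))// normrM ler_wpM2l.
  have IH' : {ae mu, forall x, forall k : 'cV[int]_d,
      B - n%:R < lamR (x + map_mx intr k) -> phi (x + map_mx intr k) = 0}.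
    by apply: ae_forall_countable => k; exact: (ae_shift (map_mx intr k) IH).
  have := ae_shift (map_mx intr km) cphi.
  apply: filterS2 IH' => x phi0 S0 Bx.
  move: S0; rewrite (bigD1_seq km)//= addrK big1_seq ?addr0 => [/eqP|k /andP[kkm kF]].
    by rewrite mulf_eq0 (negbTE ckm) => /eqP.
  have [->|ck] := eqVneq (c k) 0; first by rewrite mul0r.
  have kF' : k \in F' by rewrite mem_filter ck.
  have lk : lam (km - k) != 0.
    by apply: lP; [apply/allpairsP; exists (km, k)|rewrite subr_eq0 eq_sym].
  rewrite -addrA -map_mxB phi0 ?mulr0// lamRD lamRi.
  have : 1 <= lam (km - k) by rewrite -gtz0_ge1 lt_neqAle eq_sym lk lamB subr_ge0 kmax.
  rewrite -(ler_int R) => l1; rewrite ltrBlDr -addrA.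
  move: Bx; rewrite ltrBlDr -natr1 => /lt_le_trans; apply.
  by rewrite lerD2l [leLHS]addrC lerD2r.
apply: ntphi.
have := ae_foralln claim; apply: filterS => x xn; apply: (xn (Num.bound `|B - lamR x|)).
rewrite ltrBlDl -ltrBlDr.
exact: le_lt_trans (ler_norm _) (archi_boundP (normr_ge0 _)).
Qed.

End shifts.

(** * The inner product of L^2 *)

Section L2_inner.
Context (R : realType) (d : nat).
Local Notation mu := (lebesgue_cV R d).
Local Notation normc := ComplexField.Normc.normc.
Local Notation Re := complex.Re.
Local Notation Im := complex.Im.
Implicit Types f g e : 'cV[R]_d -> R[i].

Lemma sqr_normcE (z : R[i]) : normc z ^+ 2 = Re z ^+ 2 + Im z ^+ 2.
Proof. by case: z => x y; rewrite sqr_sqrtr// addr_ge0 ?sqr_ge0. Qed.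

Lemma measurable_normc2 f :
  measurable_fun setT (fun x => Re (f x)) -> measurable_fun setT (fun x => Im (f x)) ->
  measurable_fun setT (fun x => normc (f x) ^+ 2).
Proof.
move=> mr mi; under eq_fun do rewrite sqr_normcE.
by apply: measurable_funD; apply: measurable_funX.
Qed.

Lemma L2_integrable f : L2 f -> mu.-integrable setT (EFin \o (fun x => normc (f x) ^+ 2)).
Proof.
case=> mr mi foo; apply/integrableP; split.
  by apply/measurable_EFinP; exact: measurable_normc2.
by under eq_integral do rewrite /= ger0_norm ?sqr_ge0//.
Qed.

Lemma L2_dominated_integrable f g (h : 'cV[R]_d -> R) :
  L2 f -> L2 g -> measurable_fun setT h ->
  (forall x, `|h x| <= normc (f x) ^+ 2 + normc (g x) ^+ 2) ->
  mu.-integrable setT (EFin \o h).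
Proof.
move=> /L2_integrable fi /L2_integrable gi mh hfg.
apply: (le_integrable measurableT _ _ (integrableD measurableT fi gi)).
  exact/measurable_EFinP.
move=> x _ /=; rewrite lee_fin [leRHS]ger0_norm//.
by rewrite addr_ge0 ?sqr_ge0.
Qed.

Lemma L2_mul_integrable f g : L2 f -> L2 g ->
  mu.-integrable setT (EFin \o (fun x => Re (f x * (g x)^*))) /\
  mu.-integrable setT (EFin \o (fun x => Im (f x * (g x)^*))).
Proof.
move=> Lf Lg; have [fr fi _] := Lf; have [gr gi _] := Lg.
have Ree x : Re (f x * (g x)^*) = Re (f x) * Re (g x) + Im (f x) * Im (g x).
  by case: (f x) (g x) => a b [a' b'] /=; rewrite mulrN opprK.
have Ime x : Im (f x * (g x)^*) = Im (f x) * Re (g x) - Re (f x) * Im (g x).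
  by case: (f x) (g x) => a b [a' b'] /=; rewrite mulrN addrC.
have amgm (p q u v : R) : `|p * u + q * v| <= p ^+ 2 + q ^+ 2 + (u ^+ 2 + v ^+ 2).
  have := (sqr_ge0 (p - u), sqr_ge0 (p + u), sqr_ge0 (q - v), sqr_ge0 (q + v)).
  by move=> [[[? ?] ?] ?]; rewrite ler_norml; apply/andP; split; nra.
split; apply: (L2_dominated_integrable Lf Lg).
- under eq_fun do rewrite Ree.
  by apply: measurable_funD; apply: measurable_funM.
- by move=> x; rewrite Ree !sqr_normcE; exact: amgm.
- under eq_fun do rewrite Ime.
  by apply: measurable_funB; apply: measurable_funM.
- move=> x; rewrite Ime !sqr_normcE -mulNr -(sqrrN (Re (f x))).
  by rewrite (addrC ((- _) ^+ 2)); exact: amgm.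
Qed.

Lemma L2_0 : L2 (fun _ : 'cV[R]_d => 0 : R[i]).
Proof.
split; [exact: measurable_cst|exact: measurable_cst|].
by under eq_integral do rewrite ComplexField.Normc.normc0 expr0n /=; rewrite integral0.
Qed.

Lemma L2_dominated f g e (C : R) : L2 f -> L2 g ->
  measurable_fun setT (fun x => Re (e x)) -> measurable_fun setT (fun x => Im (e x)) ->
  (forall x, normc (e x) ^+ 2 <= C * (normc (f x) ^+ 2 + normc (g x) ^+ 2)) ->
  L2 e.
Proof.
move=> Lf Lg mr mi eC; split=> //.
have := integrable_lty measurableT (integrableZl measurableT C
  (integrableD measurableT (L2_integrable Lf) (L2_integrable Lg))).
apply: le_lt_trans; apply: ge0_le_integral => //.
- by move=> x _; rewrite lee_fin sqr_ge0.
- by apply/measurable_EFinP; exact: measurable_normc2.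
- apply/measurable_EFinP; apply: measurable_funM => //.
  have [fr fi _] := Lf; have [gr gi _] := Lg.
  by apply: measurable_funD; exact: measurable_normc2.
- by move=> x _; rewrite -EFinD -EFinM lee_fin eC.
Qed.

Lemma L2_lincomb c f g : L2 f -> L2 g -> L2 (fun x => c * f x + g x).
Proof.
move=> Lf Lg; have [fr fi _] := Lf; have [gr gi _] := Lg.
have Ree x : Re (c * f x + g x) = Re c * Re (f x) - Im c * Im (f x) + Re (g x).
  by case: {+}c (f x) (g x) => a b [a' b'] [].
have Ime x : Im (c * f x + g x) = Re c * Im (f x) + Im c * Re (f x) + Im (g x).
  by case: {+}c (f x) (g x) => a b [a' b'] [].
(* The constant comes from the parallelogram law, [|c f + g|^2 <= 2 |c|^2 |f|^2 + 2 |g|^2], with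
   both coefficients enlarged to their sum. *)
apply: (@L2_dominated f g _ (2 * normc c ^+ 2 + 2) Lf Lg).
- under eq_fun do rewrite Ree.
  apply: measurable_funD => //.
  by apply: measurable_funB; apply: measurable_funM.
- under eq_fun do rewrite Ime.
  apply: measurable_funD => //.
  by apply: measurable_funD; apply: measurable_funM.
- move=> x; rewrite !sqr_normcE Ree Ime.
  move: (Re c) (Im c) (Re (f x)) (Im (f x)) (Re (g x)) (Im (g x)) => a b p q u v.
  have -> : (a * p - b * q + u) ^+ 2 + (a * q + b * p + v) ^+ 2 =
    2 * ((a ^+ 2 + b ^+ 2) * (p ^+ 2 + q ^+ 2) + (u ^+ 2 + v ^+ 2)) -
    ((a * p - b * q - u) ^+ 2 + (a * q + b * p - v) ^+ 2) by ring.
  have := addr_ge0 (sqr_ge0 (a * p - b * q - u)) (sqr_ge0 (a * q + b * p - v)).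
  have := mulr_ge0 (addr_ge0 (sqr_ge0 a) (sqr_ge0 b)) (addr_ge0 (sqr_ge0 u) (sqr_ge0 v)).
  have := addr_ge0 (sqr_ge0 p) (sqr_ge0 q).
  move: (a * p - b * q - u) (a * q + b * p - v) => y z; nra.
Qed.

Lemma L2_sum (T : Type) (s : seq T) (c : T -> R[i]) (e : T -> 'cV[R]_d -> R[i]) :
  (forall k, L2 (e k)) -> L2 (fun x => \sum_(k <- s) c k * e k x).
Proof.
move=> Le; elim: s => [|k s IH].
  by under eq_fun do rewrite big_nil; exact: L2_0.
by under eq_fun do rewrite big_cons; exact: L2_lincomb.
Qed.

Lemma inner_lincomb c f e g : L2 f -> L2 e -> L2 g ->
  inner f (fun x => c * e x + g x) = c^* * inner f e + inner f g.
Proof.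
move=> Lf Le Lg; have [ip iq] := L2_mul_integrable Lf Le.
have [ir ii] := L2_mul_integrable Lf Lg.
have Ree x : Re (f x * (c * e x + g x)^*) =
    Re c * Re (f x * (e x)^*) + Im c * Im (f x * (e x)^*) + Re (f x * (g x)^*).
  by case: {+}c (f x) (e x) (g x) => a b [? ?] [? ?] [? ?] /=; ring.
have Ime x : Im (f x * (c * e x + g x)^*) =
    Re c * Im (f x * (e x)^*) + - Im c * Re (f x * (e x)^*) + Im (f x * (g x)^*).
  by case: {+}c (f x) (e x) (g x) => a b [? ?] [? ?] [? ?] /=; ring.
have iZ (u : 'cV[R]_d -> R) (a : R) : mu.-integrable setT (EFin \o u) ->
    mu.-integrable setT (EFin \o (fun x => a * u x)).
  by move=> /(integrableZl measurableT a).
have iD (u v : 'cV[R]_d -> R) : mu.-integrable setT (EFin \o u) ->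
    mu.-integrable setT (EFin \o v) -> mu.-integrable setT (EFin \o (fun x => u x + v x)).
  by move=> iu iv; exact: (integrableD measurableT iu iv).
rewrite /inner /cintegral.
under eq_Rintegral do rewrite Ree.
under [X in (_ +i* X)%C]eq_Rintegral do rewrite Ime.
rewrite !RintegralD ?RintegralZl//; try by [exact: iZ|apply: iD; exact: iZ].
case: {+}c => a b /=; apply/eqP; rewrite eq_complex /=; apply/andP; split; apply/eqP; ring.
Qed.

Lemma inner_conj f g : L2 f -> L2 g -> inner g f = ((inner f g)^*)%R.
Proof.
change (L2 f -> L2 g -> inner g f = conjc (inner f g)).
move=> Lf Lg; have [ip iq] := L2_mul_integrable Lf Lg.
rewrite /inner /cintegral /=; congr (_ +i* _).
  by apply: eq_Rintegral => x _; case: (f x) (g x) => a b [a' b'] /=; ring.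
rewrite -mulN1r -RintegralZl//.
by apply: eq_Rintegral => x _; case: (f x) (g x) => a b [a' b'] /=; ring.
Qed.

Lemma inner_ae0 f g : L2 f -> L2 g -> {ae mu, forall x, f x * (g x)^* = 0} -> inner f g = 0.
Proof.
move=> Lf Lg fg0; have [/integrableP[mr _] /integrableP[mi _]] := L2_mul_integrable Lf Lg.
rewrite /inner /cintegral /Rintegral.
rewrite (ae_eq_integral (cst 0%E)) ?integral0//; last first.
  by apply: filterS fg0 => x /= -> _.
rewrite (ae_eq_integral (cst 0%E)) ?integral0//.
by apply: filterS fg0 => x /= -> _.
Qed.

Lemma inner_sum (T : Type) (s : seq T) (c : T -> R[i]) (e : T -> 'cV[R]_d -> R[i]) f :
  L2 f -> (forall k, L2 (e k)) ->
  inner f (fun x => \sum_(k <- s) c k * e k x) = \sum_(k <- s) (c k)^* * inner f (e k).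
Proof.
move=> Lf Le; elim: s => [|k s IH].
  rewrite big_nil; apply: inner_ae0 => //; first exact: L2_sum.
  by apply: aeW => x; rewrite big_nil rmorph0 mulr0.
rewrite big_cons -IH -inner_lincomb//; last exact: L2_sum.
by congr inner; apply/funext => x; rewrite big_cons.
Qed.

Lemma inner_self_eq0 f : L2 f -> inner f f = 0 -> {ae mu, forall x, f x = 0}.
Proof.
move=> Lf; have fi := L2_integrable Lf; have /integrableP[mf _] := fi.
rewrite /inner /cintegral => -[+ _].
have fE x : Re (f x * (f x)^*) = normc (f x) ^+ 2.
  by rewrite sqr_normcE; case: (f x) => a b /=; ring.
under eq_Rintegral do rewrite fE.
move=> f0; have : (\int[mu]_x `|(EFin \o (fun x => normc (f x) ^+ 2)%R) x| = 0)%E.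
  under eq_integral do rewrite /= ger0_norm ?sqr_ge0//.
  by rewrite -[LHS]fineK; [congr EFin|exact: integrable_fin_num fi].
move=> /(ae_eq_integral_abs mu measurableT mf); apply: filterS => x /(_ I)/= -[].
by move=> /eqP; rewrite sqrf_eq0 => /eqP; exact: ComplexField.Normc.eq0_normc.
Qed.

Lemma dilate_shiftE (U : 'M[R]_d) k f x :
  dilate_shift U k f x = (Num.sqrt `|\det U|)%:C * f (U *m x + - map_mx intr k).
Proof. by []. Qed.

(** A single [P] serves all [k] because the change-of-variables factor does not depend on the
    translation; the Bessel bound relies on this uniformity. *)
Lemma dilate_shift_norm (U : 'M[R]_d) f : U \in unitmx -> L2 f ->
  exists2 P : R, 0 <= P & forall k,
    L2 (dilate_shift U k f) /\ \int[mu]_x (normc (dilate_shift U k f x) ^+ 2) = P.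
Proof.
move=> Uu Lf; have [c c0 cov] := affine_change_of_variables Uu.
have [fr fi foo] := Lf.
have mf := measurable_normc2 fr fi.
pose P := `|\det U| * (c * \int[mu]_x (normc (f x) ^+ 2)).
have eE k x : normc (dilate_shift U k f x) ^+ 2 =
    `|\det U| * normc (f (U *m x + - map_mx intr k)) ^+ 2.
  rewrite dilate_shiftE ComplexField.Normc.normcM exprMn; congr (_ * _).
  by rewrite /= expr0n addr0 sqrtr_sqr ger0_norm ?sqrtr_ge0// sqr_sqrtr.
have P0 : 0 <= P.
  by rewrite /P mulr_ge0// mulr_ge0 ?(ltW c0)// Rintegral_ge0// => x _; exact: sqr_ge0.
have intE k : (\int[mu]_x (normc (dilate_shift U k f x) ^+ 2)%:E = P%:E)%E.
  under eq_integral do rewrite eE EFinM.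
  rewrite ge0_integralZl//; last 2 first.
  - apply: (measurableT_comp (f := fun x => (normc (f x) ^+ 2)%:E)).
      exact/measurable_EFinP.
    exact: measurable_affine_cV.
  - by move=> x _; rewrite lee_fin sqr_ge0.
  rewrite (cov _ (fun x => (normc (f x) ^+ 2)%:E)); last 2 first.
  - exact/measurable_EFinP.
  - by move=> x; rewrite lee_fin sqr_ge0.
  rewrite /P !EFinM; congr (_ * (_ * _))%E; rewrite fineK//.
  exact: integrable_fin_num (L2_integrable Lf).
exists P => // k; split; last by rewrite /Rintegral intE.
split; last by rewrite intE ltry.
- apply: (@eq_measurable_fun _ _ _ _ _
    (fun x => Num.sqrt `|\det U| * Re (f (U *m x + - map_mx intr k)))).
    by move=> x _; rewrite dilate_shiftE; case: (f _) => a b /=; rewrite mul0r subr0.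
  apply: measurable_funM => //.
  by apply: (measurableT_comp fr); exact: measurable_affine_cV.
- apply: (@eq_measurable_fun _ _ _ _ _
    (fun x => Num.sqrt `|\det U| * Im (f (U *m x + - map_mx intr k)))).
    by move=> x _; rewrite dilate_shiftE; case: (f _) => a b /=; rewrite mul0r addr0.
  apply: measurable_funM => //.
  by apply: (measurableT_comp fi); exact: measurable_affine_cV.
Qed.

Lemma ae_normr_Rintegral_le (h u : 'cV[R]_d -> R) :
  mu.-integrable setT (EFin \o h) -> mu.-integrable setT (EFin \o u) ->
  (forall x, 0 <= u x) -> {ae mu, forall x, `|h x| <= u x} ->
  `|\int[mu]_x h x| <= \int[mu]_x u x.
Proof.
move=> ih iu u0 hu; apply: le_trans (le_normr_Rintegral measurableT ih) _.
have /integrableP[mu' _] := iu; have /integrableP[mh' _] := ih.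
apply: fine_le.
- exact: integrable_fin_num (integrable_norm ih).
- exact: integrable_fin_num iu.
apply: ae_ge0_le_integral => //.
- by apply/measurable_EFinP; apply: measurableT_comp => //; exact/measurable_EFinP.
- by move=> x _; rewrite lee_fin.
- by apply: filterS hu => x hx _; rewrite lee_fin.
Qed.

(* P + 1 rather than P, so that t = (P + 1) / m is positive also when P = 0. *)
Lemma quadratic_bound (m A P : R) : 0 <= m -> 0 <= A -> 0 <= P ->
  (forall t, 0 < t -> 2 * t * m <= t ^+ 2 * A + P) -> m ^+ 2 <= (P + 1) * A.
Proof.
move=> m0 A0 P0 tP; have [->|mn0] := eqVneq m 0.
  by rewrite expr0n mulr_ge0// addr_ge0.
have mp : 0 < m by rewrite lt_neqAle eq_sym mn0.
have P1 : 0 < P + 1 by rewrite ltr_wpDl.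
have := tP ((P + 1) / m) (divr_gt0 P1 mp).
rewrite expr_div_n -mulrA divfK// => h.
have m2 : 0 < m ^+ 2 by rewrite exprn_gt0.
have : (P + 1) <= (P + 1) ^+ 2 / m ^+ 2 * A by lra.
by rewrite mulrAC ler_pdivlMr// expr2 -mulrA ler_pM2l.
Qed.

(** * Lattice points in a box *)

Lemma int_box (m : nat) :
  exists s : seq 'cV[int]_d, forall j : 'cV[int]_d, (forall i, `|j i 0| <= m%:Z) -> j \in s.
Proof.
pose F (g : {ffun 'I_d -> 'I_(2 * m).+1}) : 'cV[int]_d := \col_i ((g i)%:Z - m%:Z).
exists (map F (enum {ffun 'I_d -> 'I_(2 * m).+1})) => j jm; apply/mapP.
exists [ffun i => inord (absz (j i 0 + m%:Z))]; first exact: mem_enum.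
apply/matrixP => i i'; rewrite !mxE ffunE ord1 inordK; have := jm i.
  by move: (j i 0) => z; lia.
by move: (j i 0) => z; lia.
Qed.

(** Since [s] is chosen before [y], its size bounds the number of lattice points near [y] uniformly
    in [y]. *)
Lemma int_box_near (L : R) : exists2 s : seq 'cV[int]_d, uniq s &
  forall y : 'cV[R]_d, exists j0 : 'cV[int]_d, forall j : 'cV[int]_d,
    (forall i, `|(y - map_mx intr j) i 0| <= L) -> j - j0 \in s.
Proof.
(* The extra 1 pays for rounding [y] down to [j0]. *)
have [s sP] := int_box (Num.bound (`|L| + 1)).
exists (undup s); first exact: undup_uniq.
move=> y; exists (\col_i Num.floor (y i 0)) => j jL; rewrite mem_undup; apply: sP => i.
rewrite !mxE -(ler_int R) intr_norm rmorphB /=.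
apply: le_trans (ltW (archi_boundP _)); last by rewrite addr_ge0.
have := jL i; rewrite !mxE => jLi.
have [yl yu] := (floor_le (y i 0), floorD1_gt (y i 0)).
rewrite rmorphD /= in yu; have := ler_norm L.
rewrite ler_norml; move: jLi; rewrite ler_norml => /andP[? ?] ?.
by apply/andP; split; lra.
Qed.

End L2_inner.

(** * Dilated shifts of a compactly supported function *)

Section dilated_shifts.
Context (R : realType) (d : nat).
Local Notation mu := (lebesgue_cV R d).
Local Notation normc := ComplexField.Normc.normc.
Local Notation Re := complex.Re.
Local Notation Im := complex.Im.
Variables (U : 'M[R]_d) (phi : 'cV[R]_d -> R[i]) (L : R).
Hypothesis Uu : U \in unitmx.
Hypothesis phiL2 : L2 phi.
Hypothesis phiL : {ae mu, forall x, phi x != 0 -> forall i, `|x i 0| <= L}.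

Let e k := dilate_shift U k phi.
Let B (k : 'cV[int]_d) (x : 'cV[R]_d) := [forall i, `|(U *m x - map_mx intr k) i 0| <= L].

Lemma dilate_shift_L2 k : L2 (e k).
Proof. by have [P _ /(_ k)[]] := dilate_shift_norm Uu phiL2. Qed.

Lemma dilate_shift_support : {ae mu, forall x, forall k, e k x != 0 -> B k x}.
Proof.
apply: ae_forall_countable => k.
apply: filterS (ae_affine (- map_mx intr k) Uu phiL) => x xL.
by rewrite /e dilate_shiftE mulf_eq0 => /norP[_ /xL ?]; apply/forallP.
Qed.

(** Where [e n] and [e m] are both nonzero, [U *m x] lies within [L] of [n] and of [m] in each
    coordinate, whence the [2 * L]. *)
Lemma inner_dilate_shift_finite m :
  exists s : seq 'cV[int]_d, forall n, inner (e n) (e m) != 0 -> n \in s.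
Proof.
have [s _ sP] := int_box_near d (2 * L).
have [j0 j0P] := sP (map_mx intr m); exists (map (+%R j0) s) => n.
move=> nm; rewrite -(subrKC j0 n) map_f// j0P// => i; rewrite leNgt.
apply: contra nm => nmL; apply/eqP/inner_ae0; [exact: dilate_shift_L2..|].
apply: filterS dilate_shift_support => x xB; apply/eqP; rewrite mulf_eq0 conjc_eq0.
apply: contraLR nmL; rewrite negb_or => /andP[/xB/forallP/(_ i) n1 /xB/forallP/(_ i) m1].
rewrite -leNgt; move: n1 m1; rewrite !mxE !ler_norml => /andP[? ?] /andP[? ?].
by apply/andP; split; lra.
Qed.

(** The indicator of [B k], written as a product over coordinates so that measurability reduces to
    intervals of the line. *)
Let ind (k : 'cV[int]_d) (x : 'cV[R]_d) : R :=
  \prod_(i < d) \1_(`[- L, L]%classic : set R) ((U *m x - map_mx intr k) i 0).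

Let indE k x : ind k x = (B k x)%:R.
Proof.
have [/forallP Bx|/forallPn[i Bx]] := boolP (B k x); rewrite /ind.
  by rewrite big1// => i _; rewrite indicE mem_setE in_itv /= -ler_norml Bx.
by rewrite (bigD1 i)//= indicE mem_setE in_itv /= -ler_norml (negbTE Bx) mul0r.
Qed.

Let measurable_ind k : measurable_fun setT (ind k).
Proof.
apply: measurable_prod => i _.
have mi : measurable_fun setT (\1_(`[- L, L]%classic : set (measurableTypeR R)) : _ -> R).
  by apply: measurable_indic; exact: measurable_itv.
exact: (measurableT_comp mi
  (measurableT_comp (measurable_coord i 0) (measurable_affine_cV U (- map_mx intr k)))).
Qed.

Let A (f : 'cV[R]_d -> R[i]) k := \int[mu]_x (ind k x * normc (f x) ^+ 2).

Let A_integrable f k : L2 f ->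
  mu.-integrable setT (EFin \o (fun x => ind k x * normc (f x) ^+ 2)).
Proof.
move=> Lf; have [fr fi _] := Lf.
apply: (L2_dominated_integrable Lf Lf).
  by apply: measurable_funM => //; exact: measurable_normc2.
move=> x; rewrite indE normrM ger0_norm ?ler0n// ger0_norm ?sqr_ge0//.
by case: B; rewrite ?mul1r ?lerDl ?mul0r ?addr_ge0 ?sqr_ge0.
Qed.

Let A_ge0 f k : 0 <= A f k.
Proof. by apply: Rintegral_ge0 => x _; rewrite indE mulr_ge0 ?sqr_ge0. Qed.

(** Cauchy-Schwarz localized to the support of [e k]: integrate [2 t |h| <= t^2 |f|^2 + |e k|^2]
    over it for every [t > 0] and optimize through [quadratic_bound]. The factor 2 in the constant
    comes from treating real and imaginary parts separately. *)
Lemma inner_dilate_shift_le f : L2 f -> exists2 C : R, 0 <= C &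
  forall k, normc (inner f (e k)) ^+ 2 <= C * A f k.
Proof.
move=> Lf; have [P P0 eP] := dilate_shift_norm Uu phiL2.
exists (2 * (P + 1)) => [|k]; first by rewrite mulr_ge0// addr_ge0.
have Le := dilate_shift_L2 k.
have bound (h : 'cV[R]_d -> R) : mu.-integrable setT (EFin \o h) ->
    (forall x, h x ^+ 2 <= normc (f x) ^+ 2 * normc (e k x) ^+ 2) ->
    (\int[mu]_x h x) ^+ 2 <= (P + 1) * A f k.
  move=> ih hfe; rewrite -real_normK ?num_real//; apply: quadratic_bound => // t t0.
  have iZ (u : 'cV[R]_d -> R) (a : R) : mu.-integrable setT (EFin \o u) ->
      mu.-integrable setT (EFin \o (fun x => a * u x)).
    by move=> /(integrableZl measurableT a).
  have iA := iZ _ (t ^+ 2) (A_integrable k Lf).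
  have ie := L2_integrable Le.
  suff : `|\int[mu]_x (2 * t * h x)| <= \int[mu]_x
      (t ^+ 2 * (ind k x * normc (f x) ^+ 2) + normc (e k x) ^+ 2).
    rewrite RintegralD//= !RintegralZl//; last exact: A_integrable.
    by rewrite (eP k).2 normrM ger0_norm// mulr_ge0// ltW.
  apply: ae_normr_Rintegral_le.
  - exact: iZ.
  - exact: (integrableD measurableT iA ie).
  - by move=> x; rewrite indE addr_ge0// ?sqr_ge0// mulr_ge0 ?sqr_ge0// mulr_ge0 ?sqr_ge0.
  apply: filterS dilate_shift_support => x xB.
  have [ek0|/xB Bx] := eqVneq (e k x) 0.
    have := hfe x; rewrite ek0 ComplexField.Normc.normc0 expr0n mulr0 => h0.
    have /eqP : h x ^+ 2 = 0 by apply/eqP; rewrite eq_le h0 sqr_ge0.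
    rewrite sqrf_eq0 => /eqP ->.
    rewrite mulr0 normr0 addr0.
    by rewrite indE mulr_ge0 ?sqr_ge0// mulr_ge0 ?sqr_ge0.
  have rhs0 : 0 <= t ^+ 2 * normc (f x) ^+ 2 + normc (e k x) ^+ 2.
    by rewrite addr_ge0 ?sqr_ge0// mulr_ge0 ?sqr_ge0.
  (* After squaring, the inequality is [(t^2 |f|^2 - |e k|^2)^2 >= 0]. *)
  rewrite indE Bx mul1r -ler_sqr ?nnegrE ?normr_ge0//.
  rewrite real_normK ?num_real// exprMn.
  have := hfe x.
  move: (h x) (normc _) (normc _) => a q p h1.
  apply: (@le_trans _ _ ((2 * t) ^+ 2 * (p ^+ 2 * q ^+ 2))).
    by rewrite ler_wpM2l// sqr_ge0.
  have := sqr_ge0 (t ^+ 2 * p ^+ 2 - q ^+ 2); lra.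
have [ir ii] := L2_mul_integrable Lf Le.
have normcJ' (z : R[i]) : normc (z^*)%R = normc z by case: z => u v /=; rewrite sqrrN.
rewrite sqr_normcE -mulrA [leRHS]mulr_natl mulr2n; apply: lerD; apply: bound => // x.
- by rewrite -exprMn -(normcJ' (e k x)) -ComplexField.Normc.normcM sqr_normcE lerDl sqr_ge0.
- by rewrite -exprMn -(normcJ' (e k x)) -ComplexField.Normc.normcM sqr_normcE lerDr sqr_ge0.
Qed.

(** Every point lies in at most [size s] of the sets [B k], so the local energies [A f k] add up to
    at most [size s] times the squared norm of [f]. *)
Lemma dilate_shift_bessel f : L2 f -> exists C : R, forall s : {fset 'cV[int]_d},
  \sum_(k <- s) normc (inner f (e k)) ^+ 2 <= C.
Proof.
move=> Lf; have [C C0 fC] := inner_dilate_shift_le Lf.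
have [s us sP] := int_box_near d L.
exists (C * ((size s)%:R * \int[mu]_x (normc (f x) ^+ 2))) => F.
apply: (@le_trans _ _ (C * \sum_(k <- F) A f k)).
  by rewrite mulr_sumr; apply: ler_sum => k _.
rewrite ler_wpM2l// -RintegralZl//; last exact: L2_integrable.
have [iF ->] : mu.-integrable setT
      (EFin \o (fun x => \sum_(k <- F) ind k x * normc (f x) ^+ 2)) /\
    \sum_(k <- F) A f k = \int[mu]_x (\sum_(k <- F) ind k x * normc (f x) ^+ 2).
  elim: (F : seq _) => [|k r [ir IH]].
    rewrite big_nil; split.
      apply: (eq_integrable measurableT (cst 0%E)) (integrable0 _ _) => x _ /=.
      by rewrite big_nil.
    by under eq_Rintegral do rewrite big_nil; rewrite /Rintegral integral0.
  have ik := A_integrable k Lf; split.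
    have := integrableD measurableT ik ir; apply: eq_integrable => // x _ /=.
    by rewrite big_cons EFinD.
  rewrite big_cons IH /A -RintegralD//.
  by apply: eq_Rintegral => x _; rewrite big_cons.
apply: le_Rintegral => //.
- exact: (integrableZl measurableT (size s)%:R (L2_integrable Lf)).
move=> x _; rewrite -mulr_suml ler_wpM2r ?sqr_ge0//.
under eq_bigr do rewrite indE.
rewrite -natr_sum ler_nat.
have [j0 j0P] := sP (U *m x).
rewrite (_ : \sum_(k <- F) _ = count (B^~ x) F)%N; last first.
  by rewrite -sum1_count [RHS]big_mkcond; apply: eq_bigr => k _; case: B.
rewrite -size_filter.
rewrite -(size_map (fun k => k - j0)); apply: uniq_leq_size.
  by rewrite map_inj_uniq ?filter_uniq ?fset_uniq//; exact: addIr.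
move=> j /mapP[k]; rewrite mem_filter => /andP[/forallP Bk _] ->.
exact: j0P.
Qed.

Lemma dilate_shift_linearly_independent (s : seq 'cV[int]_d) (c : 'cV[int]_d -> R[i]) :
  nontrivial phi -> uniq s -> {ae mu, forall x, \sum_(k <- s) c k * e k x = 0} ->
  forall k, k \in s -> c k = 0.
Proof.
move=> phi0 us ce; apply: (shifts_linearly_independent phi0 phiL us).
have := ae_affine 0 (A := invmx U) _ ce; rewrite unitmx_inv => /(_ Uu).
apply: filterS => x; rewrite addr0.
under eq_bigr do rewrite /e dilate_shiftE mulKVmx// mulrCA.
rewrite -mulr_sumr => /eqP; rewrite mulf_eq0 => /orP[|/eqP//].
rewrite (_ : 0 = 0%:C)// (inj_eq (@complexI R)) sqrtr_eq0 normr_le0.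
by move: Uu; rewrite unitmxE unitfE => /negbTE ->.
Qed.

End dilated_shifts.

(** * Subdivision and transition operators *)

Section masks.
Context (R : realType) (d : nat).
Local Notation normc := ComplexField.Normc.normc.
Local Notation lat := ('cV[int]_d).
Implicit Types (v w z : lat -> R[i]).

Lemma fsbig_setT_seq (I : choiceType) (F : I -> R[i]) (r : seq I) :
  uniq r -> (forall k, k \notin r -> F k = 0) ->
  \sum_(k \in [set: I]) F k = \sum_(k <- r) F k.
Proof.
move=> ur F0; rewrite (fsbigE r)// => [|k _]; last exact: F0.
by rewrite big_mkcond; apply: eq_bigr => k _; rewrite in_setT.
Qed.

Lemma conj_realC (x : R) : ((x%:C)^*)%R = x%:C.
Proof. exact: conjc_real. Qed.

Lemma conj_realCM (x : R) (z : R[i]) : ((x%:C * z)^*)%R = (x%:C * z^*)%R.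
Proof. by rewrite rmorphM; congr (_ * _); exact: conj_realC. Qed.

Variables (a : lat -> R) (M : 'M[int]_d).
Hypothesis aP : finitely_supported a.
Hypothesis M0 : \det M != 0.

Let mask_seq : {s : seq lat | uniq s & forall k, k \notin s -> a k = 0}.
Proof.
have /finite_seqP/cid[s sE] := aP; exists (undup s); first exact: undup_uniq.
move=> k; rewrite mem_undup => ks; apply: contrapT => /eqP ak.
have : [set` s] k by rewrite -sE.
by rewrite /= (negbTE ks).
Qed.

Let sa := s2val mask_seq.
Let sa_uniq : uniq sa. Proof. exact: (s2valP mask_seq). Qed.
Let sa0 k : k \notin sa -> a k = 0. Proof. exact: (s2valP' mask_seq). Qed.

(** [M] need not be invertible over the integers; its adjugate cancels it up to the factor
    [\det M]. *)
Lemma mulmx_intM_inj : injective (fun k : lat => M *m k).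
Proof.
move=> k k' Mkk; have : \adj M *m (M *m k) = \adj M *m (M *m k') by congr (_ *m _).
rewrite !mulmxA mul_adj_mx !mul_scalar_mx => /matrixP kk; apply/matrixP => i j.
by have := kk i j; rewrite !mxE => /(mulfI M0).
Qed.

Lemma transitionE v n : transition a M v n = \sum_(s <- sa) (a s)%:C * v (s + M *m n).
Proof.
rewrite /transition (@fsbig_setT_seq _ _ (map (+%R^~ (M *m n)) sa)).
- by rewrite big_map; apply: eq_bigr => s _; rewrite addrK conj_realC mulrC.
- by rewrite map_inj_uniq//; exact: addIr.
- move=> k kn; rewrite sa0 ?rmorph0 ?mulr0//.
  by apply: contra kn => ks; apply/mapP; exists (k - M *m n); rewrite ?subrK.
Qed.

Let quo (k : lat) : lat := xget 0 [set j | k = M *m j].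
(** [z] spread over the sublattice [M Z^d] and filled with zeros. Subdivision becomes [|det M|]
    times the convolution of [a] with it, a sum over the fixed list [sa]. The test is essential, as
    [quo] defaults to 0 off the sublattice. *)
Let upsample z (k : lat) : R[i] := if `[< exists j, k = M *m j >] then z (quo k) else 0.

Let quoM j : quo (M *m j) = j.
Proof. by apply: xget_unique => // k /mulmx_intM_inj. Qed.

Let upsampleM z j : upsample z (M *m j) = z j.
Proof. by rewrite /upsample quoM asboolT//; exists j. Qed.

Let upsample0 z k : (forall j, k <> M *m j) -> upsample z k = 0.
Proof. by move=> kM; rewrite /upsample asboolF// => -[j /kM]. Qed.

Lemma subdivisionE z n :
  subdivision a M z n = `|\det M|%:~R * \sum_(s <- sa) (a s)%:C * upsample z (n - s).
Proof.
congr (_ * _); pose P s := `[< exists j, n - s = M *m j >].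
have quoK s : P s -> M *m quo (n - s) = n - s.
  by move=> /asboolP/(xgetPex 0) /= nsE; exact: esym nsE.
rewrite (@fsbig_setT_seq _ _ [seq quo (n - s) | s <- sa & P s]).
- rewrite big_map big_filter [RHS](bigID P) /= [X in _ + X]big1 ?addr0; last first.
    by move=> s /negbTE Ps; rewrite /upsample -/(P s) Ps mulr0.
  apply: eq_bigr => s Ps; rewrite /upsample -/(P s) Ps quoK// opprB.
  by rewrite addrCA subrr addr0 mulrC.
- rewrite map_inj_in_uniq ?filter_uniq// => s t.
  rewrite !mem_filter => /andP[Ps _] /andP[Pt _] /(congr1 (mulmx M)).
  by rewrite !quoK// => /addrI/oppr_inj.
- move=> k kn; rewrite sa0 ?mulr0//; apply: contra kn => kn.
  apply/mapP; exists (n - M *m k); last by rewrite opprB addrCA subrr addr0 quoM.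
  by rewrite mem_filter kn andbT; apply/asboolP; exists k; rewrite opprB addrCA subrr addr0.
Qed.

(** A row is a list of coefficients paired with indices. Repeated indices are allowed, so sums and
    products of matrices need no merging of entries. *)
Definition finite_rows (T : (lat -> R[i]) -> lat -> R[i]) :=
  forall n, exists r : seq (R[i] * lat), forall v, T v n = \sum_(p <- r) p.1 * v p.2.

(** Phrased as preservation of finite support, the property passes to compositions at once. *)
Definition finite_columns (T : (lat -> R[i]) -> lat -> R[i]) :=
  forall v (r : seq lat), (forall k, v k != 0 -> k \in r) ->
  exists r' : seq lat, forall k, T v k != 0 -> k \in r'.

Lemma transition_finite_rows : finite_rows (transition a M).
Proof.
move=> n; exists [seq ((a s)%:C, s + M *m n) | s <- sa] => v.
by rewrite transitionE big_map.
Qed.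

Lemma subdivision_finite_rows : finite_rows (subdivision a M).
Proof.
(* Positions [n - s] off the sublattice stay in the row with coefficient 0, at the default index. *)
move=> n; exists [seq (`|\det M|%:~R * ((a s)%:C *
    (`[< exists j, n - s = M *m j >])%:R), quo (n - s)) | s <- sa] => v.
rewrite subdivisionE big_map mulr_sumr; apply: eq_bigr => s _ /=.
by rewrite /upsample -!mulrA; case: ifP; rewrite ?mul1r// mul0r.
Qed.

Lemma transition_finite_columns : finite_columns (transition a M).
Proof.
(* Pairs with [k - s] off the sublattice contribute a spurious 0, harmless since only an inclusion
   is claimed. *)
move=> v r vr; exists [seq quo (k - s) | k <- r, s <- sa] => n.
rewrite transitionE => Tn.
have [s ssa /vr sr] : exists2 s, s \in sa & v (s + M *m n) != 0.
  apply: contrapT => nex; move/eqP: Tn; apply; rewrite big_seq big1// => s ssa.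
  have [->|vs] := eqVneq (v (s + M *m n)) 0; first by rewrite mulr0.
  by exfalso; apply: nex; exists s.
apply/allpairsP; exists (s + M *m n, s); split=> //=.
by rewrite addrC addKr quoM.
Qed.

Lemma subdivision_finite_columns : finite_columns (subdivision a M).
Proof.
move=> z r zr; exists [seq s + M *m k | s <- sa, k <- r] => n.
rewrite subdivisionE => Sn.
have [s ssa us] : exists2 s, s \in sa & upsample z (n - s) != 0.
  apply: contrapT => nex; move/eqP: Sn; apply; rewrite big_seq big1 ?mulr0// => s ssa.
  have [->|us] := eqVneq (upsample z (n - s)) 0; first by rewrite mulr0.
  by exfalso; apply: nex; exists s.
have [j nj] : exists j, n - s = M *m j.
  by apply: contrapT => nj; move/eqP: us; apply; apply: upsample0 => j nsj; apply: nj; exists j.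
apply/allpairsP; exists (s, j); split=> //=; last by rewrite -nj addrC subrK.
by apply: zr; rewrite -(upsampleM z) -nj.
Qed.

(** * Square summable sequences and the adjoint relation *)

Definition square_summable v :=
  exists C : R, forall s : {fset lat}, \sum_(k <- s) normc (v k) ^+ 2 <= C.

Lemma square_summable_reindex (h : lat -> lat) v :
  injective h -> square_summable v -> square_summable (v \o h).
Proof.
move=> hI [C vC]; exists C => s; apply: le_trans (vC (h @` s)%fset).
by rewrite big_imfset//= => x y _ _ /hI.
Qed.

Lemma square_summable_lincomb c v w :
  square_summable v -> square_summable w -> square_summable (fun k => c * v k + w k).
Proof.
move=> [C vC] [D wD]; exists (2 * normc c ^+ 2 * C + 2 * D) => s.
apply: (@le_trans _ _ (2 * normc c ^+ 2 * (\sum_(k <- s) normc (v k) ^+ 2) +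
    2 * \sum_(k <- s) normc (w k) ^+ 2)); last first.
  by apply: lerD; rewrite ler_wpM2l// mulr_ge0// sqr_ge0.
rewrite !mulr_sumr -big_split /=; apply: ler_sum => k _.
have := le_normcD (c * v k) (w k); rewrite ComplexField.Normc.normcM => h.
apply: (@le_trans _ _ ((normc c * normc (v k) + normc (w k)) ^+ 2)).
  by rewrite ler_sqr ?nnegrE ?normc_ge0// addr_ge0 ?normc_ge0// mulr_ge0 ?normc_ge0.
have := sqr_ge0 (normc c * normc (v k) - normc (w k)); nra.
Qed.

Lemma square_summable0 : square_summable (fun _ => 0).
Proof. by exists 0 => s; rewrite big1// => k _; rewrite ComplexField.Normc.normc0 expr0n. Qed.

Lemma square_summable_sum (T : Type) (r : seq T) (c : T -> R[i]) (v : T -> lat -> R[i]) :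
  (forall s, square_summable (v s)) -> square_summable (fun k => \sum_(s <- r) c s * v s k).
Proof.
move=> vs; elim: r => [|s r IH].
  by under eq_fun do rewrite big_nil; exact: square_summable0.
by under eq_fun do rewrite big_cons; exact: square_summable_lincomb.
Qed.

Lemma square_summable_has_sum v w : square_summable v -> square_summable w ->
  exists s, has_sum (fun k => v k * (w k)^*) s.
Proof.
move=> [C vC] [D wD]; apply: (@normc_bounded_has_sum _ _ _ (C + D)) => s.
apply: (@le_trans _ _ (\sum_(k <- s) (normc (v k) ^+ 2 + normc (w k) ^+ 2))).
  apply: ler_sum => k _; rewrite ComplexField.Normc.normcM.
  have -> : normc ((w k)^*)%R = normc (w k) by case: (w k) => x y /=; rewrite sqrrN.
  have := sqr_ge0 (normc (v k) - normc (w k)); have := sqr_ge0 (normc (v k) + normc (w k)); nra.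
by rewrite big_split lerD.
Qed.

Lemma transition_square_summable v : square_summable v -> square_summable (transition a M v).
Proof.
move=> vs.
have -> : transition a M v = fun n => \sum_(s <- sa) (a s)%:C * (v \o (fun n => s + M *m n)) n.
  by apply/funext => n; rewrite transitionE.
apply: square_summable_sum => s; apply: square_summable_reindex vs.
by move=> k k' /addrI/mulmx_intM_inj.
Qed.

(* For each s in the support of a, the terms v(s + M n) z(n)^* are those of
   k |-> v(k) z'(k - s)^* along the injection n |-> s + M n, where z' is the
   upsampling of z; so only finitely many series are added. *)
Lemma subdivision_adjoint v z : square_summable v -> square_summable z ->
  exists2 s, has_sum (fun n => transition a M v n * (z n)^*) s &
    has_sum (fun k => v k * (subdivision a M z k)^*) (`|\det M|%:~R * s).
Proof.
move=> vs zs.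
have hI s : injective (fun n : lat => s + M *m n) by move=> k k' /addrI/mulmx_intM_inj.
have ex s : exists t, has_sum (fun n => v (s + M *m n) * (z n)^*) t.
  exact: (square_summable_has_sum (square_summable_reindex (hI s) vs) zs).
pose t s := sval (cid (ex s)); have tP s := svalP (cid (ex s)).
exists (\sum_(s <- sa) (a s)%:C * t s).
  have := has_sum_big (r := sa) (fun s => has_sumZ (c := (a s)%:C) (tP s)); congr has_sum.
  apply/funext => n; rewrite transitionE mulr_suml.
  by apply: eq_bigr => s _; rewrite mulrA.
have tP' s : has_sum (fun k => v k * (upsample z (k - s))^*) (t s).
  apply: (has_sum_reindex (hI s)).
    move=> k kh; rewrite upsample0 ?rmorph0 ?mulr0// => j kj.
    by apply: (kh j); rewrite -kj addrC subrK.
  have := tP s; congr has_sum; apply/funext => n /=.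
  by rewrite [s + _]addrC addrK upsampleM.
have := has_sumZ (c := `|\det M|%:~R)
  (has_sum_big (r := sa) (fun s => has_sumZ (c := (a s)%:C) (tP' s))).
congr has_sum; apply/funext => k; rewrite subdivisionE rmorphM rmorph_sum /= mulrCA.
rewrite rmorph_int; congr (_ * _); rewrite mulr_sumr; apply: eq_bigr => s _.
by rewrite conj_realCM mulrCA.
Qed.

(** * Dilated shifts of a refined function *)

Section refine.
Variables (U : 'M[R]_d) (phi : 'cV[R]_d -> R[i]).
Hypothesis Uu : U \in unitmx.
Hypothesis phiL2 : L2 phi.

Let e k := dilate_shift U k phi.
Let psi n := dilate_shift (invmx (map_mx intr M) *m U) n (refine a M phi).
Let q : R := Num.sqrt `|(\det M)%:~R|.

Let detM : \det (map_mx intr M : 'M[R]_d) = (\det M)%:~R.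
Proof. by rewrite det_map_mx. Qed.

Let Mu : (map_mx intr M : 'M[R]_d) \in unitmx.
Proof. by rewrite unitmxE detM unitfE intr_eq0. Qed.

(** Multiplying [M^-1 U x - n] by [M] and subtracting [s] gives [U x - (s + M n)]. The factor
    [|det M|] of [refine] meets [|det M|^(-1/2)] from the dilation, which leaves [q]. *)
Lemma dilate_shift_refine n x :
  psi n x = \sum_(s <- sa) (q * a s)%:C * e (s + M *m n) x.
Proof.
rewrite /psi dilate_shiftE /refine (@fsbig_setT_seq _ _ sa)//; last first.
  by move=> k /sa0 ->; rewrite mul0r.
have -> : `|\det M|%:~R = (q ^+ 2)%:C :> R[i].
  by rewrite sqr_sqrtr// -intr_norm rmorph_int.
have q0 : q != 0 by rewrite sqrtr_eq0 normr_le0 intr_eq0.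
rewrite !mulr_sumr; apply: eq_bigr => s _; rewrite /e dilate_shiftE.
rewrite -mulmxA mulmxDr mulKVmx//.
have -> : map_mx intr M *m - map_mx intr n = - map_mx intr (M *m n) :> 'cV[R]_d.
  by rewrite mulmxN map_mxM.
rewrite -addrA -opprD -map_mxD [M *m n + s]addrC.
rewrite !mulrA -!rmorphM /=; congr (_%:C * _).
rewrite det_mulmx det_inv detM normrM normfV sqrtrM ?invr_ge0// sqrtrV// -/q.
by field.
Qed.

Lemma refine_L2 n : L2 (psi n).
Proof.
have -> : psi n = fun x => \sum_(s <- sa) (q * a s)%:C * e (s + M *m n) x.
  by apply/funext => x; exact: dilate_shift_refine.
by apply: L2_sum => s; exact: dilate_shift_L2.
Qed.

Lemma inner_refine f n : L2 f ->
  inner f (psi n) = q%:C * transition a M (fun k => inner f (e k)) n.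
Proof.
move=> Lf.
have -> : psi n = fun x => \sum_(s <- sa) (q * a s)%:C * e (s + M *m n) x.
  by apply/funext => x; exact: dilate_shift_refine.
rewrite (inner_sum sa (fun s => (q * a s)%:C)) //; last first.
  by move=> s; exact: dilate_shift_L2.
rewrite transitionE mulr_sumr; apply: eq_bigr => s _.
by rewrite conj_realC rmorphM mulrA.
Qed.

Lemma frame_sum_refine f g : L2 f -> L2 g ->
  square_summable (fun k => inner f (e k)) -> square_summable (fun k => inner g (e k)) ->
  has_sum (fun k => inner f (e k) *
      (subdivision a M (transition a M (fun k => inner g (e k))) k)^*)
    (frame_sum (invmx (map_mx intr M) *m U) (refine a M phi) f g).
Proof.
move=> Lf Lg vs ws.
have [s Ts] := subdivision_adjoint vs (transition_square_summable ws).
congr has_sum; apply/esym/has_sum_lattice.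
have := has_sumZ (c := `|\det M|%:~R) Ts; congr has_sum; apply/funext => n.
rewrite (inner_refine n Lf) (inner_conj Lg (refine_L2 n)) (inner_refine n Lg).
rewrite conj_realCM mulrACA; congr (_ * _).
by rewrite -rmorphM /= -expr2 sqr_sqrtr// -intr_norm rmorph_int.
Qed.

End refine.

End masks.

(** * Matrices with finite rows and columns *)

Section finite_matrices.
Context (R : realType) (d : nat).
Local Notation lat := ('cV[int]_d).
Implicit Types (T S : (lat -> R[i]) -> lat -> R[i]).

Lemma finite_rows_comp T S : finite_rows T -> finite_rows S -> finite_rows (T \o S).
Proof.
move=> Tr Sr n; have [r rE] := Tr n.
pose u k := sval (cid (Sr k)); have uE k v : S v k = \sum_(p <- u k) p.1 * v p.2.
  exact: svalP (cid (Sr k)) v.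
exists [seq (p.1 * p'.1, p'.2) | p <- r, p' <- u p.2] => v /=.
rewrite rE big_allpairs_dep; apply: eq_bigr => p _.
by rewrite uE mulr_sumr; apply: eq_bigr => p' _; rewrite mulrA.
Qed.

Lemma finite_rows_sum (I : Type) (r : seq I) (T : I -> (lat -> R[i]) -> lat -> R[i]) :
  (forall i, finite_rows (T i)) -> finite_rows (fun v k => \sum_(i <- r) T i v k).
Proof.
move=> Tr n; pose u i := sval (cid (Tr i n)).
have uE i v : T i v n = \sum_(p <- u i) p.1 * v p.2 by exact: svalP (cid (Tr i n)) v.
exists (flatten [seq u i | i <- r]) => v.
by rewrite big_flatten big_map; apply: eq_bigr => i _; rewrite uE.
Qed.

Lemma finite_rows_subid T : finite_rows T -> finite_rows (fun v k => T v k - v k).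
Proof.
move=> Tr n; have [r rE] := Tr n; exists ((-1, n) :: r) => v.
by rewrite big_cons rE /= mulN1r addrC.
Qed.

Lemma finite_columns_comp T S : finite_columns T -> finite_columns S -> finite_columns (T \o S).
Proof. by move=> Tc Sc v r /Sc[r' /Tc]. Qed.

Lemma finite_columns_sum (I : Type) (r : seq I) (T : I -> (lat -> R[i]) -> lat -> R[i]) :
  (forall i, finite_columns (T i)) -> finite_columns (fun v k => \sum_(i <- r) T i v k).
Proof.
move=> Tc v s vs; elim: r => [|i r [s' s'P]].
  by exists [::] => k; rewrite big_nil eqxx.
have [t tP] := Tc i v s vs; exists (t ++ s') => k; rewrite big_cons mem_cat.
have [->|/tP ->//] := eqVneq (T i v k) 0.
by rewrite add0r => /s'P ->; rewrite orbT.
Qed.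

Lemma finite_columns_subid T : finite_columns T -> finite_columns (fun v k => T v k - v k).
Proof.
move=> Tc v r vr; have [s sP] := Tc v r vr; exists (s ++ r) => k; rewrite mem_cat.
have [->|/sP ->//] := eqVneq (T v k) 0.
by rewrite sub0r oppr_eq0 => /vr ->; rewrite orbT.
Qed.

End finite_matrices.

(** * Matrices that vanish when tested against the dilated shifts *)

Section rigidity.
Context (R : realType) (d : nat).
Variables (U : 'M[R]_d) (phi : 'cV[R]_d -> R[i]) (L : R).
Hypothesis Uu : U \in unitmx.
Hypothesis phiL2 : L2 phi.
Hypothesis phi_nontrivial : nontrivial phi.
Hypothesis phiL : {ae lebesgue_cV R d, forall x, phi x != 0 -> forall i, `|x i 0| <= L}.
Local Notation lat := ('cV[int]_d).
Let e k := dilate_shift U k phi.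
Let eL2 k : L2 (e k). Proof. exact: dilate_shift_L2. Qed.

Lemma span_orthogonal_eq0 (s : seq lat) (c : lat -> R[i]) : uniq s ->
  inner (fun x => \sum_(k <- s) c k * e k x) (fun x => \sum_(k <- s) c k * e k x) = 0 ->
  forall k, k \in s -> c k = 0.
Proof.
move=> us /inner_self_eq0 ce0.
exact: (dilate_shift_linearly_independent Uu phiL phi_nontrivial us (ce0 (L2_sum _ _ eL2))).
Qed.

(* Testing against f in the span of the e_k kills P v_g for every g in that
   span; then take for g the combination of the e_k read off the n-th row of P. *)
Lemma finite_matrix_eq0 (P : (lat -> R[i]) -> lat -> R[i]) :
  finite_rows P -> finite_columns P ->
  (forall f g, L2 f -> L2 g ->
    has_sum (fun k => inner f (e k) * (P (fun k => inner g (e k)) k)^*) 0) ->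
  forall v n, P v n = 0.
Proof.
move=> Pr Pc Pfg v n.
have Pspan (s : seq lat) (c : lat -> R[i]) m :
    P (fun k => inner (fun x => \sum_(k <- s) c k * e k x) (e k)) m = 0.
  pose g x := \sum_(k <- s) c k * e k x; rewrite -/g; have Lg : L2 g by exact: L2_sum.
  have [r rP] : exists r : seq lat, forall k, inner g (e k) != 0 -> k \in r.
    pose u k := sval (cid (inner_dilate_shift_finite Uu phiL2 phiL k)).
    have uP k j : inner (e j) (e k) != 0 -> j \in u k.
      exact: svalP (cid (inner_dilate_shift_finite Uu phiL2 phiL k)) j.
    exists (flatten [seq u k | k <- s]) => k gk.
    apply: contrapT => ku; move/eqP: gk; apply.
    rewrite (inner_conj (eL2 k) Lg) (inner_sum s c)//; apply/eqP; rewrite conjC_eq0; apply/eqP.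
    rewrite big_seq big1// => j js.
    have [->|kj] := eqVneq (inner (e k) (e j)) 0; first by rewrite mulr0.
    exfalso; apply: ku; apply/flattenP; exists (u j); last exact: uP.
    exact: map_f.
  have [r' r'P] := Pc _ r rP.
  pose w k := P (fun k => inner g (e k)) k.
  pose h x := \sum_(k <- undup r') w k * e k x.
  have Lh : L2 h by exact: L2_sum.
  have hE f : L2 f -> inner f h = 0.
    move=> Lf; rewrite (inner_sum (undup r') w)//.
    have w0 k : k \notin undup r' -> inner f (e k) * (w k)^* = 0.
      rewrite mem_undup => kr; have [->|/r'P wk] := eqVneq (w k) 0.
        by rewrite rmorph0 mulr0.
      by rewrite wk in kr.
    have := has_sum_lattice (Pfg f g Lf Lg).
    rewrite (has_sum_lattice (has_sum_fin (undup_uniq r') w0)) => S0; rewrite -[RHS]S0.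
    by apply: eq_bigr => k _; rewrite mulrC.
  have [mr|mr] := boolP (m \in undup r').
    exact: (span_orthogonal_eq0 (undup_uniq r') (hE h Lh) mr).
  by move: mr; rewrite mem_undup => /negP mr; apply: contrapT => /eqP /r'P.
have [r rE] := Pr n.
(* The row may list an index several times; [c] merges these entries, as independence needs distinct
   indices. *)
pose s := undup (map snd r); pose c k := \sum_(p <- r | p.2 == k) p.1.
have sE w : \sum_(p <- r) p.1 * w p.2 = \sum_(k <- s) c k * w k.
  under [RHS]eq_bigr do rewrite /c mulr_suml.
  rewrite (exchange_big_dep xpredT)//= big_seq [RHS]big_seq; apply: eq_bigr => p pr.
  rewrite (eq_bigl (fun k => k == p.2)) => [|k]; last by rewrite eq_sym.
  by rewrite -big_filter filter_pred1_uniq ?undup_uniq ?mem_undup ?map_f// big_seq1.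
have c0 k : k \in s -> (c k)^* = 0.
  apply: (@span_orthogonal_eq0 s (fun k => (c k)^*)); first exact: undup_uniq.
  (* The coefficients are conjugated because [inner] is antilinear in its second argument: thus
     [inner g g] is exactly the [n]-th entry of [P v_g]. *)
  pose g x := \sum_(k <- s) (c k)^* * e k x; rewrite -/g.
  have Lg : L2 g by exact: L2_sum.
  rewrite [in X in inner _ X]/g (inner_sum s (fun k => (c k)^*))//.
  have := Pspan s (fun k => (c k)^*) n; rewrite -/g rE (sE (fun k => inner g (e k))).
  move=> S0; rewrite -[RHS]S0.
  by apply: eq_bigr => j _; congr (_ * _); exact: conjcK.
rewrite rE sE big_seq big1// => k /c0 /eqP; rewrite conjc_eq0 => /eqP ->.
by rewrite mul0r.
Qed.

End rigidity.
(* M0 and M l, l : 'I_r, are the matrices M_0 and M_1, ..., M_r. *)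
Theorem theorem3p1 (R : realType) (d r : nat) (d_ge1 : (1 <= d)%N)
    (r_ge1 : (1 <= r)%N)
    (M0 : 'M[int]_d) (M : 'I_r -> 'M[int]_d)
    (M0_inv : \det M0 != 0) (M_inv : forall l, \det (M l) != 0)
    (a : 'I_r -> 'cV[int]_d -> R) (a_fin : forall l, finitely_supported (a l))
    (phi : 'cV[R]_d -> R[i]) (phi_L2 : L2 phi)
    (phi_nontrivial : nontrivial phi) (phi_compact : compactly_supported phi)
    (psi : 'I_r -> 'cV[R]_d -> R[i])
    (psiE : forall l, psi l = refine (a l) (M l) phi) :
  (forall v : 'cV[int]_d -> R[i], forall n : 'cV[int]_d,
     \sum_(l < r) subdivision (a l) (M l) (transition (a l) (M l) v) n = v n)
  <->
  (forall f g : 'cV[R]_d -> R[i], L2 f -> L2 g ->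
     frame_sum (map_mx intr M0) phi f g =
     \sum_(l < r)
       frame_sum (invmx (map_mx intr (M l)) *m map_mx intr M0) (psi l) f g).
Proof.
set U : 'M[R]_d := map_mx intr M0.
have Uu : U \in unitmx by rewrite unitmxE det_map_mx unitfE intr_eq0.
have [L phiL] := compactly_supported_bounded phi_compact.
pose v f k := inner f (dilate_shift U k phi).
pose ST l := subdivision (a l) (M l) \o transition (a l) (M l).
have vs f : L2 f -> square_summable (v f).
  by move=> Lf; exact: (dilate_shift_bessel Uu phi_L2 phiL Lf).
have FS0 f g : L2 f -> L2 g ->
    has_sum (fun k => v f k * (v g k)^*) (frame_sum U phi f g).
  move=> Lf Lg; have [s Fs] := square_summable_has_sum (vs f Lf) (vs g Lg).
  have := Fs; congr has_sum; apply/esym/has_sum_lattice.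
  have := Fs; congr has_sum; apply/funext => k; congr (_ * _).
  by rewrite (inner_conj Lg (dilate_shift_L2 Uu phi_L2 k)).
(* Moving [ST l] onto [v g] turns the sums over the coarser lattices into one sum over the index [k]
   of [FS0], with the same factor [v f k], so that the two sides can be subtracted term by term. *)
have FS1 f g : L2 f -> L2 g ->
    has_sum (fun k => v f k * (\sum_(l < r) ST l (v g) k)^*)
      (\sum_(l < r) frame_sum (invmx (map_mx intr (M l)) *m U) (psi l) f g).
  move=> Lf Lg; under [X in has_sum _ X]eq_bigr do rewrite psiE.
  have := has_sum_big (r := index_enum 'I_r) (fun l =>
    frame_sum_refine (a_fin l) (M_inv l) Uu phi_L2 Lf Lg (vs f Lf) (vs g Lg)).
  by congr has_sum; apply/funext => k; rewrite rmorph_sum mulr_sumr.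
split=> [STid f g Lf Lg|FS w n].
  rewrite -(has_sum_lattice (FS0 f g Lf Lg)) -(has_sum_lattice (FS1 f g Lf Lg)).
  by congr lattice_sum; apply/funext => k; rewrite STid.
apply/eqP; rewrite -subr_eq0; apply/eqP; move: w n.
apply: (finite_matrix_eq0 Uu phi_L2 phi_nontrivial phiL
  (P := fun w k => \sum_(l < r) ST l w k - w k)).
- apply: finite_rows_subid; apply: finite_rows_sum => l; apply: finite_rows_comp.
    exact: subdivision_finite_rows.
  exact: transition_finite_rows.
- apply: finite_columns_subid; apply: finite_columns_sum => l; apply: finite_columns_comp.
    exact: subdivision_finite_columns.
  exact: transition_finite_columns.
move=> f g Lf Lg.
have := has_sumD (FS1 f g Lf Lg) (has_sumZ (c := -1) (FS0 f g Lf Lg)).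
rewrite FS// mulN1r subrr; congr has_sum; apply/funext => k.
by rewrite rmorphB mulrBr mulN1r.
Qed.
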